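(* Let $N,m,n\ge 1$ be integers and, for $k=1,\dots,N$, let $\mathbf{J}^{(k)}\in\mathbb{R}^{m\times n}$, $\mathbf{b}^{(k)},\mathbf{c}^{(k)}\in\mathbb{R}^m$ and $w^{(k)}>0$. Let $f:\mathbb{R}^n\to\mathbb{R}$ be $$f(\mathbf{x})=\sum_{k=1}^N w^{(k)}\left[\log\left(\mathbf{1}_m^\top\exp(\mathbf{J}^{(k)}\mathbf{x}+\mathbf{b}^{(k)})\right)-{\mathbf{c}^{(k)}}^\top\mathbf{J}^{(k)}\mathbf{x}\right].$$ Assume that $\inf_{\mathbf{x}\in\mathbb{R}^n}f(\mathbf{x})$ is attained in $\mathbb{R}$, i.e. $f$ has a global minimizer. Then, for every initial guess $\mathbf{x}_0\in\mathbb{R}^n$, the sequence $\{\mathbf{x}_i\}_{i\ge 0}$ generated by the LSEMINK iteration (defined in the context) converges to a global minimizer of $f$.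
   Context: Notation: $\mathbf{1}_m\in\mathbb{R}^m$ is the all-ones vector, $\exp$ of a vector and division of a vector by a scalar are applied entrywise. For $\mathbf{x}\in\mathbb{R}^n$ put $$\mathbf{p}^{(k)}(\mathbf{x})=\frac{\exp(\mathbf{J}^{(k)}\mathbf{x}+\mathbf{b}^{(k)})}{\mathbf{1}_m^\top\exp(\mathbf{J}^{(k)}\mathbf{x}+\mathbf{b}^{(k)})},\qquad \mathbf{H}^{(k)}(\mathbf{x})=\mathrm{diag}(\mathbf{p}^{(k)}(\mathbf{x}))-\mathbf{p}^{(k)}(\mathbf{x})\mathbf{p}^{(k)}(\mathbf{x})^\top ,$$ so that $\nabla f(\mathbf{x})=\sum_k w^{(k)}{\mathbf{J}^{(k)}}^\top(\mathbf{p}^{(k)}(\mathbf{x})-\mathbf{c}^{(k)})$ and $\nabla^2 f(\mathbf{x})=\sum_k w^{(k)}{\mathbf{J}^{(k)}}^\top\mathbf{H}^{(k)}(\mathbf{x})\mathbf{J}^{(k)}$. For $\beta>0$ define the shifted Hessian $$\mathbf{A}_\beta(\mathbf{x})=\sum_{k=1}^N w^{(k)}{\mathbf{J}^{(k)}}^\top\left(\mathbf{H}^{(k)}(\mathbf{x})+\beta\mathbf{I}\right)\mathbf{J}^{(k)} .$$ For $r\ge 1$ let $\mathcal{K}_r(\mathbf{A},\mathbf{g})=\mathrm{span}\{\mathbf{g},\mathbf{A}\mathbf{g},\dots,\mathbf{A}^{r-1}\mathbf{g}\}$. Trial update: for a current point $\mathbf{x}$ with $\nabla f(\mathbf{x})\ne\mathbf{0}$,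 a parameter $\beta>0$ and $r\ge1$, let $\mathbf{V}$ be a matrix whose columns form an orthonormal basis of $\mathcal{K}_r(\mathbf{A}_\beta(\mathbf{x}),\nabla f(\mathbf{x}))$, let $\mathbf{T}=\mathbf{V}^\top\mathbf{A}_\beta(\mathbf{x})\mathbf{V}$ (which is invertible), and set $\Delta\mathbf{x}=-\mathbf{V}\mathbf{T}^{-1}\mathbf{V}^\top\nabla f(\mathbf{x})$. This is the approximate solution of the Newton equation $\mathbf{A}_\beta(\mathbf{x})\Delta\mathbf{x}=-\nabla f(\mathbf{x})$ produced by $r$ steps of a Krylov subspace method (conjugate gradients started at $\mathbf{0}$). In each trial, $r$ is the smallest integer $\ge 1$ for which the relative residual $\|\mathbf{A}_\beta(\mathbf{x})\Delta\mathbf{x}+\nabla f(\mathbf{x})\|_2/\|\nabla f(\mathbf{x})\|_2$ is below a fixed tolerance $\mathrm{ktol}>0$ or $r$ equals a fixed maximum $\mathrm{kmaxiter}\ge1$. LSEMINK iteration: fix a line search parameter $\gamma\in(0,1)$, an initial $\beta_0>0$ and an initial guess $\mathbf{x}_0\in\mathbb{R}^n$. For $i=0,1,2,\dots$: (1) If $\nabla f(\mathbf{x}_i)=\mathbf{0}$, set $\mathbf{x}_{i+1}=\mathbf{x}_i$ (and $\beta_{i+1}=\beta_i$). (2) Otherwise, compute the trial update $\Delta\mathbf{x}_i$ at $\mathbf{x}_i$ with the current $\beta_i$. If $f(\mathbf{x}_i+\Delta\mathbf{x}_i)<f(\mathbf{x}_i)+\gamma\nabla f(\mathbf{x}_i)^\top\Delta\mathbf{x}_i$,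 accept: $\mathbf{x}_{i+1}=\mathbf{x}_i+\Delta\mathbf{x}_i$. Otherwise replace $\beta_i$ by $2\beta_i$ and recompute the trial update, repeating until acceptance. (3) If the first trial in step (2) was accepted, set $\beta_{i+1}=\beta_i/2$; otherwise set $\beta_{i+1}=\beta_i$, the last (accepted) value. *)

(* Defs.v *)
From HB Require Import structures.
From mathcomp Require Import all_boot all_order all_algebra.
From mathcomp Require Import all_classical all_reals all_analysis.

Set Implicit Arguments.
Unset Strict Implicit.
Unset Printing Implicit Defensive.

Import Order.TTheory GRing.Theory Num.Theory.
Import numFieldNormedType.Exports.

Local Open Scope ring_scope.

Definition dot (R : realType) (n : nat) (u v : 'cV[R]_n) : R :=
  (u^T *m v) 0 0.

(* The library norm `|v| on matrices is the sup norm. *)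
Definition norm2 (R : realType) (n : nat) (v : 'cV[R]_n) : R :=
  Num.sqrt (dot v v).

Definition gradient (R : realType) (n : nat) (f : 'cV[R]_n -> R)
  (x : 'cV[R]_n) : 'cV[R]_n :=
  \col_(j < n) 'D_(delta_mx j 0) f x.

Definition global_minimizer (R : realType) (n : nat) (f : 'cV[R]_n -> R)
  (x : 'cV[R]_n) : Prop := forall y, f x <= f y.

Definition expv (R : realType) (m n : nat) (J : 'M[R]_(m, n)) (b : 'cV[R]_m)
  (x : 'cV[R]_n) : 'cV[R]_m := map_mx expR (J *m x + b).

Definition sumexp (R : realType) (m n : nat) (J : 'M[R]_(m, n))
  (b : 'cV[R]_m) (x : 'cV[R]_n) : R := dot (const_mx 1) (expv J b x).

Definition lse_objective (R : realType) (N m n : nat)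
  (J : 'I_N -> 'M[R]_(m, n)) (b c : 'I_N -> 'cV[R]_m) (w : 'I_N -> R)
  (x : 'cV[R]_n) : R :=
  \sum_(k < N) w k * (ln (sumexp (J k) (b k) x) - dot (c k) (J k *m x)).

Definition softmax (R : realType) (m n : nat) (J : 'M[R]_(m, n))
  (b : 'cV[R]_m) (x : 'cV[R]_n) : 'cV[R]_m :=
  (sumexp J b x)^-1 *: expv J b x.

Definition softmax_hess (R : realType) (m n : nat) (J : 'M[R]_(m, n))
  (b : 'cV[R]_m) (x : 'cV[R]_n) : 'M[R]_m :=
  let p := softmax J b x in diag_mx p^T - p *m p^T.

Definition shifted_hessian (R : realType) (N m n : nat)
  (J : 'I_N -> 'M[R]_(m, n)) (b : 'I_N -> 'cV[R]_m) (w : 'I_N -> R)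
  (beta : R) (x : 'cV[R]_n) : 'M[R]_n :=
  \sum_(k < N)
    w k *: ((J k)^T *m (softmax_hess (J k) (b k) x + beta%:M) *m J k).

Definition krylov (R : realType) (n r : nat) (A : 'M[R]_n) (g : 'cV[R]_n) :
  {vspace 'cV[R]_n} := <<mkseq (fun i => A ^+ i *m g) r>>%VS.

Definition orthonormal_basis_mx (R : realType) (n d : nat)
  (U : {vspace 'cV[R]_n}) (V : 'M[R]_(n, d)) : Prop :=
  basis_of U [seq col j V | j <- enum 'I_d] /\ V^T *m V = 1%:M.

(* [dx] approximately solves A dx = - g from the Krylov space of order [r].
   It does not depend on the choice of the orthonormal basis [V]. *)
Definition krylov_update (R : realType) (n r : nat) (A : 'M[R]_n)
  (g dx : 'cV[R]_n) : Prop :=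
  exists (d : nat) (V : 'M[R]_(n, d)),
    orthonormal_basis_mx (krylov r A g) V /\
    dx = - (V *m invmx (V^T *m A *m V) *m V^T *m g).

Definition krylov_stop (R : realType) (n : nat) (ktol : R) (kmaxiter : nat)
  (A : 'M[R]_n) (g : 'cV[R]_n) (r : nat) (dx : 'cV[R]_n) : Prop :=
  norm2 (A *m dx + g) / norm2 g < ktol \/ r = kmaxiter.

Definition trial_update (R : realType) (n : nat) (ktol : R) (kmaxiter : nat)
  (A : 'M[R]_n) (g dx : 'cV[R]_n) : Prop :=
  exists r : nat,
    [/\ (1 <= r)%N,
        krylov_update r A g dx,
        krylov_stop ktol kmaxiter A g r dx &
        forall (s : nat) (dy : 'cV[R]_n), (1 <= s < r)%N ->
          krylov_update s A g dy -> ~ krylov_stop ktol kmaxiter A g s dy].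

Definition armijo (R : realType) (n : nat) (gamma : R) (f : 'cV[R]_n -> R)
  (x dx : 'cV[R]_n) : Prop :=
  f (x + dx) < f x + gamma * dot (gradient f x) dx.

(* One iteration from (x, beta) to (x', beta'), where [A beta x] is the shifted
   Hessian; [j] is the number of trials rejected by the line search, each of
   which doubles beta. *)
Definition lsemink_step (R : realType) (n : nat) (gamma ktol : R)
  (kmaxiter : nat) (f : 'cV[R]_n -> R) (A : R -> 'cV[R]_n -> 'M[R]_n)
  (x : 'cV[R]_n) (beta : R) (x' : 'cV[R]_n) (beta' : R) : Prop :=
  let trial i dx :=
    trial_update ktol kmaxiter (A (2 ^+ i * beta) x) (gradient f x) dx in
  (gradient f x = 0 -> x' = x /\ beta' = beta) /\
  (gradient f x <> 0 ->
     exists (j : nat) (dx : 'cV[R]_n),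
       [/\ trial j dx /\ armijo gamma f x dx,
           forall (i : nat) (dy : 'cV[R]_n), (i < j)%N ->
             trial i dy -> ~ armijo gamma f x dy,
           x' = x + dx &
           beta' = if j == 0%N then beta / 2 else 2 ^+ j * beta]).

Definition lsemink_sequence (R : realType) (n : nat) (gamma ktol : R)
  (kmaxiter : nat) (f : 'cV[R]_n -> R) (A : R -> 'cV[R]_n -> 'M[R]_n)
  (x0 : 'cV[R]_n) (beta0 : R) (x_ : nat -> 'cV[R]_n) (beta_ : nat -> R) :
  Prop :=
  [/\ x_ 0%N = x0,
      beta_ 0%N = beta0 &
      forall i : nat, lsemink_step gamma ktol kmaxiter f A
        (x_ i) (beta_ i) (x_ i.+1) (beta_ i.+1)].

(* Main.v *)
Require Import Defs.
From HB Require Import structures.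
From mathcomp Require Import all_boot all_order all_algebra.
From mathcomp Require Import all_classical all_reals all_analysis.
From mathcomp Require Import ring lra.

(** Write [g] for the gradient and [S = sum_k w_k J_k^T J_k] for the matrix that
    multiplies [beta] in the shifted Hessian [A_beta = H + beta S].

    The remainder [f (x + d) - f x - g.d] is a sum over [k] of logarithms
    [ln (sum_j p_j exp (u_j))], where [p] is the softmax weight vector at [x] and
    [u] is [J_k d] centered to have mean 0 under [p] ([lse_bregman]).  Elementary
    bounds on the exponential give [0 <= remainder <= 8 d.Sd]; this yields
    convexity, the gradient formula, and, since [A_beta >= beta S], acceptance of
    every trial with [beta (1 - gamma) > 8].  Hence the accepted [beta] stay
    bounded, and each accepted step decreases [f] by a fixed multiple of [g.g].

    The function [f] may be affine in some directions, so its sublevel sets need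
    not be compact.  Let [Q] be the Hessian at a minimizer.  Its kernel consists
    of the directions in which all [J_k] are constant vectors, and it is
    orthogonal to every gradient.  On a sublevel set, [J_k (x - xmin)] is bounded
    up to constant vectors ([sublevel_bound]), so the softmax weights are
    comparable with those at the minimizer, and [f] is strongly convex there for
    the seminorm of [Q].  This gives [f x - min f <= C g.g]
    ([gradient_domination]), and therefore [f x_i - min f] tends to 0
    geometrically.

    Convergence of the iterates themselves requires [d.d <= C g.g] with [C]
    independent of [beta], although [beta] may tend to 0 and [H] is singular.
    For the exact solution of [A_beta d = - g] this holds because testing
    the equation against the kernel of [Q] removes both [H] and [g], and leaves
    the equation [S d] orthogonal to this kernel, in which [beta] does not occur
    ([exact_newton_bound]).  For a truncated Krylov solution it follows from
    the theorem of Hestenes and Stiefel that the norms of the conjugate gradient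
    iterates increase ([iterate_norm_monotone]).  The steps are then bounded by a
    geometric sequence, so the iterates converge, and the limit is a minimizer by
    convexity. *)

Set Implicit Arguments.
Unset Strict Implicit.
Unset Printing Implicit Defensive.

Import Order.TTheory GRing.Theory Num.Theory.
Import numFieldNormedType.Exports.

Local Open Scope classical_set_scope.
Local Open Scope ring_scope.

(** * Semidefinite quadratic forms *)

Section Dot.
Context {R : realType}.

Lemma dotE n (u v : 'cV[R]_n) : dot u v = \sum_i u i 0 * v i 0.
Proof. by rewrite /dot mxE; apply: eq_bigr => i _; rewrite mxE. Qed.

Lemma dotC n (u v : 'cV[R]_n) : dot u v = dot v u.
Proof. by rewrite !dotE; apply: eq_bigr => i _; rewrite mulrC. Qed.

Lemma dotDr n (u v w : 'cV[R]_n) : dot u (v + w) = dot u v + dot u w.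
Proof. by rewrite /dot mulmxDr mxE. Qed.

Lemma dotDl n (u v w : 'cV[R]_n) : dot (v + w) u = dot v u + dot w u.
Proof. by rewrite dotC dotDr !(dotC u). Qed.

Lemma dotZr n a (u v : 'cV[R]_n) : dot u (a *: v) = a * dot u v.
Proof. by rewrite /dot -scalemxAr mxE. Qed.

Lemma dotZl n a (u v : 'cV[R]_n) : dot (a *: u) v = a * dot u v.
Proof. by rewrite dotC dotZr dotC. Qed.

Lemma dotNr n (u v : 'cV[R]_n) : dot u (- v) = - dot u v.
Proof. by rewrite -scaleN1r dotZr mulN1r. Qed.

Lemma dotNl n (u v : 'cV[R]_n) : dot (- u) v = - dot u v.
Proof. by rewrite dotC dotNr dotC. Qed.

Lemma dotBr n (u v w : 'cV[R]_n) : dot u (v - w) = dot u v - dot u w.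
Proof. by rewrite dotDr dotNr. Qed.

Lemma dotBl n (u v w : 'cV[R]_n) : dot (v - w) u = dot v u - dot w u.
Proof. by rewrite dotDl dotNl. Qed.

Lemma dot0r n (u : 'cV[R]_n) : dot u 0 = 0.
Proof. by rewrite /dot mulmx0 mxE. Qed.

Lemma dot0l n (u : 'cV[R]_n) : dot 0 u = 0.
Proof. by rewrite dotC dot0r. Qed.

Lemma dot_suml n I (r : seq I) (F : I -> 'cV[R]_n) u :
  dot (\sum_(i <- r) F i) u = \sum_(i <- r) dot (F i) u.
Proof.
elim: r => [|i r IH]; first by rewrite !big_nil dot0l.
by rewrite !big_cons dotDl IH.
Qed.

Lemma dot_sumr n I (r : seq I) (F : I -> 'cV[R]_n) u :
  dot u (\sum_(i <- r) F i) = \sum_(i <- r) dot u (F i).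
Proof. by rewrite dotC dot_suml; apply: eq_bigr => i _; rewrite dotC. Qed.

Lemma dot_adjoint m n (A : 'M[R]_(m, n)) u v :
  dot u (A *m v) = dot (A^T *m u) v.
Proof. by rewrite /dot trmx_mul trmxK mulmxA. Qed.

Lemma dot_ge0 n (v : 'cV[R]_n) : 0 <= dot v v.
Proof. by rewrite dotE; apply: sumr_ge0 => i _; rewrite -expr2 sqr_ge0. Qed.

Lemma sqr_coord_le_dot n (v : 'cV[R]_n) i : v i 0 ^+ 2 <= dot v v.
Proof.
rewrite dotE (bigD1 i) //= expr2 lerDl; apply: sumr_ge0 => j _.
by rewrite -expr2 sqr_ge0.
Qed.

Lemma dot_eq0 n (v : 'cV[R]_n) : dot v v = 0 -> v = 0.
Proof.
move=> v0; apply/colP => i; rewrite mxE.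
have := sqr_coord_le_dot v i; rewrite v0 => h.
by apply/eqP; rewrite -sqrf_eq0 eq_le h sqr_ge0.
Qed.

Lemma dot_gt0 n (v : 'cV[R]_n) : v <> 0 -> 0 < dot v v.
Proof.
move=> v0; rewrite lt_neqAle dot_ge0 andbT eq_sym.
by apply/eqP => /dot_eq0.
Qed.

End Dot.

Section PositiveSemidefinite.
Context {R : realType}.

Definition psdmx n (A : 'M[R]_n) : Prop :=
  A^T = A /\ forall v, 0 <= dot v (A *m v).

Lemma dot_symmx n (A : 'M[R]_n) u v :
  A^T = A -> dot u (A *m v) = dot v (A *m u).
Proof. by move=> sA; rewrite dot_adjoint sA dotC. Qed.

(** The polynomial inequality 0 <= (u + t v).A(u + t v) at the minimizing t; the
    degenerate case v.Av = 0 uses a large t instead. *)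
Lemma psd_cauchy_schwarz n (A : 'M[R]_n) u v : psdmx A ->
  dot u (A *m v) ^+ 2 <= dot u (A *m u) * dot v (A *m v).
Proof.
move=> [sA pA].
have q t : 0 <= dot u (A *m u) + 2 * t * dot u (A *m v)
               + t ^+ 2 * dot v (A *m v).
  have := pA (u + t *: v); rewrite mulmxDr -scalemxAr !(dotDl, dotDr, dotZl, dotZr).
  rewrite (dot_symmx v u sA); move=> h.
  by apply: le_trans h _; rewrite le_eqVlt; apply/orP; left; apply/eqP; ring.
move: (dot u (A *m u)) (dot u (A *m v)) (dot v (A *m v)) (pA v) (pA u) q.
move=> a b c c0 a0 q.
have [c_eq0|c_neq0] := eqVneq c 0.
  have [->|b0] := eqVneq b 0; first by rewrite expr2 !mul0r mulr_ge0.
  have := q (- (a + 1) / (2 * b)); rewrite c_eq0.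
  have -> : a + 2 * (- (a + 1) / (2 * b)) * b
     + (- (a + 1) / (2 * b)) ^+ 2 * 0 = -1 by field; exact: b0.
  by rewrite oppr_ge0 ler10.
have cp : 0 < c by rewrite lt_neqAle eq_sym c_neq0.
have := q (- b / c).
have -> : a + 2 * (- b / c) * b + (- b / c) ^+ 2 * c = (a * c - b ^+ 2) / c.
  by field.
by rewrite pmulr_lge0 ?invr_gt0 // subr_ge0.
Qed.

Lemma quad_bound n (A : 'M[R]_n) :
  exists2 L, 0 < L & forall v, dot v (A *m v) <= L * dot v v.
Proof.
exists (1 + \sum_i \sum_j `|A i j|).
  by rewrite ltr_wpDr // sumr_ge0 // => i _; apply: sumr_ge0.
move=> v; rewrite mulrDl mul1r ler_wpDl ?dot_ge0 //.
rewrite [leLHS]dotE mulr_suml; apply: ler_sum => i _.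
rewrite mxE mulr_sumr mulr_suml; apply: ler_sum => j _.
apply: le_trans (ler_norm _) _.
rewrite !normrM mulrCA ler_wpM2l //.
have := sqr_coord_le_dot v i; have := sqr_coord_le_dot v j.
rewrite -(real_normK (num_real (v i 0))) -(real_normK (num_real (v j 0))).
move: (normr_ge0 (v i 0)) (normr_ge0 (v j 0)).
move: `|v i 0| `|v j 0| (dot v v) => a b d; nra.
Qed.

Lemma psd_kernel n (A : 'M[R]_n) v :
  psdmx A -> dot v (A *m v) = 0 -> A *m v = 0.
Proof.
move=> pA v0; apply: dot_eq0; apply/eqP; rewrite -sqrf_eq0 eq_le sqr_ge0 andbT.
by have := psd_cauchy_schwarz (A *m v) v pA; rewrite v0 mulr0.
Qed.

(** A vector orthogonal to the kernel of a semidefinite [A] is in its range, so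
    [g = A u] with [u] linear in [g]; Cauchy-Schwarz for the form of [A] then
    applies to [g.v = u.Av].  Taking [v = g] shows that [A] is coercive on the
    orthogonal complement of its kernel. *)
Lemma psd_range_bound n (A : 'M[R]_n) : psdmx A ->
  exists2 C, 0 < C & forall g v, (forall z, A *m z = 0 -> dot g z = 0) ->
    dot g v ^+ 2 <= C * dot g g * dot v (A *m v).
Proof.
move=> pA; have [L L0 hL] := quad_bound (pinvmx A)^T.
exists L => // g v hg.
pose u := (g^T *m pinvmx A)^T.
have gE : A *m u = g.
  have sub : (g^T <= A)%MS.
    rewrite submxE; apply/eqP/matrixP => i j; rewrite !ord1 [RHS]mxE.
    rewrite -[RHS](hg (col j (cokermx A))); last first.
      by rewrite colE mulmxA mulmx_coker mul0mx.
    by rewrite /dot !mxE; apply: eq_bigr => k _; rewrite !mxE.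
  by rewrite -[A in LHS]pA.1 -trmx_mul mulmxKpV // trmxK.
have uAu : dot u (A *m u) <= L * dot g g.
  by rewrite gE dotC /u trmx_mul trmxK; apply: hL.
have -> : dot g v = dot u (A *m v) by rewrite -gE dotC dot_symmx ?pA.1.
apply: le_trans (psd_cauchy_schwarz _ _ pA) _.
by rewrite ler_wpM2r ?(pA.2 v).
Qed.

Lemma psd_mul_bound n (A : 'M[R]_n) : psdmx A ->
  exists2 L, 0 < L & forall v, dot (A *m v) (A *m v) <= L * dot v (A *m v).
Proof.
move=> pA; have [L L0 hL] := quad_bound A; exists L => // v.
have := psd_cauchy_schwarz (A *m v) v pA.
have := dot_ge0 (A *m v); have := hL (A *m v); have := pA.2 v.
move: (dot (A *m v) _) (dot (A *m v) (A *m (A *m v))) (dot v (A *m v)) => a e q.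
move=> q0 ea a0; have [->|an0] := eqVneq a 0; first by rewrite mulr_ge0 // ltW.
have ap : 0 < a by rewrite lt_neqAle eq_sym an0.
move=> h; rewrite -(ler_pM2l ap); nra.
Qed.

Lemma psd_coercive n (A : 'M[R]_n) : psdmx A ->
  exists2 C, 0 < C & forall v, (forall z, A *m z = 0 -> dot v z = 0) ->
    dot v v <= C * dot v (A *m v).
Proof.
move=> pA; have [C C0 hC] := psd_range_bound pA; exists C => // v vA.
have := hC v v vA.
have [->|vn0] := eqVneq (dot v v) 0; first by rewrite mulr_ge0 ?pA.2 // ltW.
have vp : 0 < dot v v by rewrite lt_neqAle eq_sym vn0 dot_ge0.
by move=> h; rewrite -(ler_pM2l vp) -expr2 mulrCA mulrA.
Qed.

(** The hypothesis says that [d] has the least energy for [S] among the vectors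
    that differ from it by an element of the kernel of [Q]; it puts [S d] in the
    range of [Q], so that [psd_range_bound] bounds [Sd.d]. *)
Lemma psd_compare n (Q S : 'M[R]_n) : psdmx Q -> psdmx S ->
  exists2 C, 0 < C & forall d, (forall z, Q *m z = 0 -> dot (S *m d) z = 0) ->
    dot d (S *m d) <= C * dot d (Q *m d).
Proof.
move=> pQ pS; have [C C0 hC] := psd_range_bound pQ.
have [L L0 hL] := psd_mul_bound pS; exists (C * L); first exact: mulr_gt0.
move=> d dQ; have := hC _ d dQ; have := hL d; have := pQ.2 d; have := pS.2 d.
rewrite (dotC (S *m d) d); move: (dot d (S *m d)) (dot d (Q *m d)).
move=> s q s0 q0 hs hsq.
have [->|sn0] := eqVneq s 0; first by rewrite !mulr_ge0 // ltW.
have sp : 0 < s by rewrite lt_neqAle eq_sym sn0.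
rewrite -(ler_pM2l sp) -expr2; apply: le_trans hsq _.
by rewrite [leRHS]mulrA ler_wpM2r // mulrCA ler_pM2l // mulrC.
Qed.

End PositiveSemidefinite.

(** * Galerkin solutions in Krylov spaces *)

Section GramSchmidt.
Context {R : realType}.

Lemma mem_span_cols n d (V : 'M[R]_(n, d)) x :
  (x \in <<[seq col j V | j <- enum 'I_d]>>%VS) <-> exists y, x = V *m y.
Proof.
rewrite -[X in <<X>>%VS]/(val [tuple col j V | j < d]); split.
  move/coord_span => {1}->; exists (\col_j coord [tuple col j V | j < d] j x).
  apply/colP => i; rewrite summxE mxE; apply: eq_bigr => j _.
  by rewrite mxE -tnth_nth tnth_mktuple !mxE mulrC.
case=> y ->.
have -> : V *m y = \sum_j y j 0 *: col j V.
  apply/colP => i; rewrite summxE mxE; apply: eq_bigr => j _.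
  by rewrite !mxE mulrC.
apply: memv_suml => j _; apply: memvZ; apply: memv_span.
by apply/tnthP; exists j; rewrite tnth_mktuple.
Qed.

(** Gram-Schmidt, one spanning vector at a time: the new column is the
    normalized component of [v] orthogonal to the columns already built. *)
Lemma gram_schmidt n (vs : seq 'cV[R]_n) : exists d (V : 'M[R]_(n, d)),
  V^T *m V = 1%:M /\ forall x, x \in <<vs>>%VS <-> exists y, x = V *m y.
Proof.
elim: vs => [|v vs [d [V [oV hV]]]].
  exists 0%N, 0; split=> [|x]; first by apply/matrixP => -[].
  rewrite span_nil memv0; split=> [/eqP ->|[y ->]]; last by rewrite mul0mx.
  by exists 0; rewrite mulmx0.
pose v' := v - V *m (V^T *m v).
have vE : v = v' + V *m (V^T *m v) by rewrite subrK.
have av a : a *: v = a *: v' + a *: (V *m (V^T *m v)).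
  by rewrite -scalerDr -vE.
have Vv' : V^T *m v' = 0 by rewrite mulmxBr (mulmxA V^T V) oV mul1mx subrr.
have spanE x : x \in <<v :: vs>>%VS <-> exists a y, x = a *: v' + V *m y.
  rewrite span_cons; split.
    case/memv_addP => _ /vlineP[a ->] [z /hV[y ->] ->].
    exists a, (a *: (V^T *m v) + y).
    by rewrite av mulmxDr -scalemxAr addrA.
  move=> [a [y ->]]; apply/memv_addP.
  exists (a *: v); first by apply: memvZ; apply: memv_line.
  exists (V *m (y - a *: (V^T *m v))); first by apply/hV; eexists.
  by rewrite av mulmxBr -scalemxAr -addrA; congr (_ + _); rewrite addrC subrK.
have [v'0|v'0] := eqVneq v' 0.
  exists d, V; split=> // x; rewrite spanE v'0; split.
    by move=> [a [y ->]]; exists y; rewrite scaler0 add0r.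
  by move=> [y ->]; exists 0, y; rewrite scaler0 add0r.
have v'p : 0 < dot v' v' by apply: dot_gt0; apply/eqP.
pose t := Num.sqrt (dot v' v').
have t0 : t != 0 by rewrite gt_eqF // sqrtr_gt0.
exists (1 + d)%N, (row_mx (t^-1 *: v') V); split.
  have vt : (t^-1 *: v')^T = t^-1 *: v'^T by rewrite linearZ.
  rewrite tr_row_mx mul_col_row oV vt -!scalemxAl -!scalemxAr Vv'.
  rewrite (scalar_mx_block 1 d) scaler0; congr block_mx.
    apply/matrixP => i j; rewrite !ord1 !mxE /=.
    have -> : \sum_k v'^T 0 k * v' k 0 = t ^+ 2.
      by rewrite sqr_sqrtr ?dot_ge0 // /dot mxE.
    by rewrite expr2 mulKf // mulVf.
  rewrite -[LHS]trmxK linearZ /= trmx_mul trmxK Vv' scaler0.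
  by apply/matrixP => i j; rewrite !mxE.
move=> x; rewrite spanE; split.
  move=> [a [y ->]]; exists (col_mx (const_mx (t * a)) y).
  rewrite mul_row_col; congr (_ + _); apply/colP => i.
  by rewrite !mxE big_ord1 !mxE mulrAC mulrA mulVf // mul1r.
move=> [y ->]; exists (t^-1 * y 0 0), (dsubmx y).
rewrite -{1}[y]vsubmxK mul_row_col; congr (_ + _); apply/colP => i.
by rewrite !mxE big_ord1 !mxE mulrAC; congr (_ * y _ _ * _); apply: val_inj.
Qed.

Lemma orthonormal_basis_mxP n d (U : {vspace 'cV[R]_n}) (V : 'M[R]_(n, d)) :
  V^T *m V = 1%:M -> (forall x, x \in U <-> exists y, x = V *m y) ->
  orthonormal_basis_mx U V.
Proof.
move=> oV hV; split=> //; apply/andP; split.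
  apply/eqP/vspaceP => x.
  by apply/idP/idP => [/mem_span_cols/hV|/hV/mem_span_cols].
rewrite -[X in free X]/(val [tuple col j V | j < d]).
apply/freeP => k; under eq_bigr do rewrite -tnth_nth tnth_mktuple.
move=> k0 i.
have kV : V *m \col_j k j = 0.
  rewrite -[RHS]k0; apply/colP => l; rewrite summxE mxE; apply: eq_bigr => j _.
  by rewrite !mxE mulrC.
have : V^T *m (V *m \col_j k j) = 0 by rewrite kV mulmx0.
by rewrite mulmxA oV mul1mx => /colP/(_ i); rewrite !mxE.
Qed.

Lemma ex_orthonormal_basis n (U : {vspace 'cV[R]_n}) :
  exists d (V : 'M[R]_(n, d)), orthonormal_basis_mx U V.
Proof.
have [d [V [oV hV]]] := gram_schmidt (vbasis U).
exists d, V; apply: orthonormal_basis_mxP => // x.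
by rewrite -hV (span_basis (vbasisP U)).
Qed.

Lemma mem_orthonormal_basis n d (U : {vspace 'cV[R]_n}) (V : 'M[R]_(n, d)) x :
  orthonormal_basis_mx U V -> (x \in U <-> exists y, x = V *m y).
Proof. by move=> [bV _]; rewrite -(span_basis bV); apply: mem_span_cols. Qed.

End GramSchmidt.

Section Galerkin.
Context {R : realType}.

(** A Krylov update does not depend on the basis chosen: it is the Galerkin
    solution of [A d = - g] in the Krylov space. *)
Definition galerkin n (A : 'M[R]_n) g (U : {vspace 'cV[R]_n}) d : Prop :=
  d \in U /\ forall v, v \in U -> dot v (A *m d + g) = 0.

Definition definite_on n (A : 'M[R]_n) (U : {vspace 'cV[R]_n}) : Prop :=
  forall v, v \in U -> dot v (A *m v) = 0 -> v = 0.

Lemma galerkin_unique n (A : 'M[R]_n) g U d d' :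
  definite_on A U -> galerkin A g U d -> galerkin A g U d' -> d = d'.
Proof.
move=> pd [dU dg] [d'U d'g]; apply/eqP; rewrite -subr_eq0; apply/eqP.
have dd : d - d' \in U by rewrite rpredB.
apply: pd => //; have := dg _ dd; have := d'g _ dd; rewrite mulmxBr dotBr !dotDr.
lra.
Qed.

Lemma projected_unitmx n d (A : 'M[R]_n) U (V : 'M[R]_(n, d)) :
  definite_on A U -> orthonormal_basis_mx U V -> V^T *m A *m V \in unitmx.
Proof.
move=> pd bV; rewrite -unitmx_tr -row_free_unit; apply: inj_row_free => u.
move=> /(congr1 trmx); rewrite trmx_mul !trmxK trmx0 => Tu.
have /pd Vu : V *m u^T \in U by apply/(mem_orthonormal_basis _ bV); eexists.
have VAV : dot (V *m u^T) (A *m (V *m u^T)) = 0.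
  by rewrite dotC dot_adjoint !mulmxA -(mulmxA V^T) mulmxA Tu dot0l.
by rewrite -[u]trmxK -[u^T]mul1mx -bV.2 -mulmxA Vu // mulmx0 trmx0.
Qed.

Lemma projected_solve_galerkin n d (A : 'M[R]_n) g U (V : 'M[R]_(n, d)) :
  definite_on A U -> orthonormal_basis_mx U V ->
  galerkin A g U (- (V *m invmx (V^T *m A *m V) *m V^T *m g)).
Proof.
move=> pd bV; have uT := projected_unitmx pd bV; split.
  apply/(mem_orthonormal_basis _ bV).
  by exists (- (invmx (V^T *m A *m V) *m V^T *m g)); rewrite mulmxN !mulmxA.
move=> v /(mem_orthonormal_basis _ bV)[y ->].
rewrite dotC dot_adjoint mulmxDr !mulmxN !mulmxA.
rewrite -[V^T *m A *m V *m invmx _ *m _ *m _]mulmxA.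
by rewrite mulmxV // mul1mx addNr dot0l.
Qed.

Lemma krylov_update_galerkin n r (A : 'M[R]_n) g d :
  definite_on A (krylov r A g) -> krylov_update r A g d ->
  galerkin A g (krylov r A g) d.
Proof. by move=> pd [k [V [bV ->]]]; apply: projected_solve_galerkin. Qed.

Lemma ex_krylov_update n r (A : 'M[R]_n) g : exists d, krylov_update r A g d.
Proof.
have [k [V bV]] := ex_orthonormal_basis (krylov r A g).
by eexists; exists k, V; split; first exact: bV.
Qed.

Section Energy.
Variables (n : nat) (A : 'M[R]_n) (g : 'cV[R]_n) (U : {vspace 'cV[R]_n}).
Variable d : 'cV[R]_n.
Hypothesis gal : galerkin A g U d.

Lemma galerkin_energy : dot d (A *m d) = - dot g d.
Proof. by have := gal.2 _ gal.1; rewrite dotDr (dotC d g); lra. Qed.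

(** Testing the Galerkin equation against [g] itself gives [g.g = - g.Ad]; by
    Cauchy-Schwarz the slope along the update is at least that of a gradient step
    of length [1 / L]. *)
Lemma galerkin_descent L : psdmx A -> g \in U ->
  dot g (A *m g) <= L * dot g g -> dot g g <= L * - dot g d.
Proof.
move=> pA gU hL; have := gal.2 _ gU; rewrite dotDr => h.
have := psd_cauchy_schwarz g d pA; rewrite galerkin_energy.
have dA : 0 <= - dot g d by rewrite -galerkin_energy; apply: pA.2.
have [g0|g0] := eqVneq (dot g g) 0.
  by move=> _; rewrite (dot_eq0 g0) !dot0l oppr0 mulr0.
have gp : 0 < dot g g by rewrite lt_neqAle eq_sym g0 dot_ge0.
have -> : dot g (A *m d) = - dot g g by lra.
move=> h1; rewrite -(ler_pM2l gp); apply: le_trans (_ : _ <= _) _.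
  by rewrite -expr2 -sqrrN; apply: h1.
by rewrite [leRHS]mulrA ler_wpM2r // mulrC.
Qed.

End Energy.

End Galerkin.

Section Krylov.
Context {R : realType}.
Variables (n : nat) (A : 'M[R]_n) (g : 'cV[R]_n).
Local Notation K r := (krylov r A g).

Lemma krylov0 v : v \in K 0 -> v = 0.
Proof. by rewrite /krylov /= span_nil memv0 => /eqP. Qed.

Lemma krylovS r v :
  v \in K r.+1 <-> exists2 u, u \in K r & exists a, v = u + a *: (A ^+ r *m g).
Proof.
rewrite /krylov mkseqS -cats1 span_cat span_seq1; split.
  by case/memv_addP => u uK [_ /vlineP[a ->] ->]; exists u => //; exists a.
move=> [u uK [a ->]]; apply/memv_addP; exists u => //.
by exists (a *: (A ^+ r *m g)) => //; apply: memvZ; apply: memv_line.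
Qed.

Lemma krylov_subS r : {subset K r <= K r.+1}.
Proof.
by move=> v vK; apply/krylovS; exists v => //; exists 0; rewrite scale0r addr0.
Qed.

Lemma krylov_sub r s : (r <= s)%N -> {subset K r <= K s}.
Proof.
move=> /subnK <-; elim: (s - r)%N => // k IH v /IH.
by rewrite addSn; apply: krylov_subS.
Qed.

Lemma krylov_gen r : A ^+ r *m g \in K r.+1.
Proof.
apply/krylovS; exists 0; first exact: mem0v.
by exists 1; rewrite add0r scale1r.
Qed.

Lemma krylov_start r : (0 < r)%N -> g \in K r.
Proof.
move=> r0; apply: (krylov_sub r0).
by have := krylov_gen 0; rewrite expr0 mul1mx.
Qed.

Lemma krylov_mul r v : v \in K r -> A *m v \in K r.+1.
Proof.
elim: r v => [|r IH] v; first by move/krylov0 ->; rewrite mulmx0 mem0v.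
move/krylovS => [u uK [a ->]]; rewrite mulmxDr -scalemxAr rpredD //.
  by apply: krylov_subS; apply: IH.
by rewrite mulmxA -[A *m A ^+ r](exprS A r); apply: memvZ; apply: krylov_gen.
Qed.

Lemma krylov_ind (P : 'cV[R]_n -> Prop) :
  P 0 -> (forall u v, P u -> P v -> P (u + v)) -> (forall a u, P u -> P (a *: u)) ->
  P g -> (forall u, P (A *m u)) -> forall r v, v \in K r -> P v.
Proof.
move=> P0 PD PZ Pg PA; elim=> [|r IH] v; first by move/krylov0 ->.
move=> /krylovS[u /IH Pu [a ->]]; apply: PD => //; apply: PZ.
by case: r {IH} => [|r]; [rewrite expr0 mul1mx | rewrite exprS -mulmxA].
Qed.

(** Each Krylov space is at most one dimension larger than the previous one. *)
Lemma krylov_complete r e v : e \in K r.+1 -> e \notin K r -> v \in K r.+1 ->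
  exists2 u, u \in K r & exists c, v = u + c *: e.
Proof.
move=> /krylovS[u uK [a eE]] eK /krylovS[u' u'K [a' ->]].
have a0 : a != 0.
  by apply: contra eK => /eqP a0; rewrite eE a0 scale0r addr0.
exists (u' - (a' / a) *: u); first by rewrite rpredB // rpredZ.
exists (a' / a); rewrite eE scalerDr scalerA divfK // addrA subrK //.
Qed.

Hypothesis psdA : psdmx A.
Hypothesis pdK : forall r, definite_on A (K r).

Section Chain.
Variable d : nat -> 'cV[R]_n.
Hypothesis dG : forall r, galerkin A g (K r) (d r).

Lemma residual_mem r : A *m d r + g \in K r.+1.
Proof. by rewrite rpredD ?krylov_start // krylov_mul // (dG r).1. Qed.

Lemma residual0_stationary r s : (r <= s)%N -> A *m d r + g = 0 -> d s = d r.
Proof.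
move=> rs r0; apply: galerkin_unique (pdK (r := s)) (dG s) _; split.
  by apply: krylov_sub rs _ (dG r).1.
by move=> v _; rewrite r0 dot0r.
Qed.

(** The Hestenes-Stiefel monotonicity of conjugate gradients.  The increment
    [e1 = d r.+2 - d r.+1] and its predecessor [e0] span, modulo [K r], the space
    [K r.+2]; since all three of [e0], [e1] and the residual [rho] are
    A-orthogonal to [K r], [rho] is a combination of [e0] and [e1].  The
    Galerkin orthogonality gives the signs of the two coefficients, whence
    [d.e1 >= 0] follows from [d.e0 >= 0]. *)
Lemma iterate_dot_increment_ge0 r : 0 <= dot (d r) (d r.+1 - d r).
Proof.
elim: r => [|r IH]; first by rewrite (krylov0 (dG 0).1) dot0l.
have [sA pA] := psdA.
pose rho0 := A *m d r + g; pose rho := A *m d r.+1 + g.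
pose rho2 := A *m d r.+2 + g.
pose e0 := d r.+1 - d r; pose e1 := d r.+2 - d r.+1.
rewrite -/e1.
have [rho_0|rho_n0] := eqVneq rho 0.
  by rewrite /e1 (residual0_stationary (leqnSn r.+1) rho_0) subrr dot0r.
have rhop : 0 < dot rho rho by apply: dot_gt0; apply/eqP.
have Ae0 : A *m e0 = rho - rho0.
  by rewrite mulmxBr /rho /rho0 opprD addrACA subrr addr0.
have Ae1 : A *m e1 = rho2 - rho.
  by rewrite mulmxBr /rho2 /rho opprD addrACA subrr addr0.
have rho0K : rho0 \in K r.+1 by apply: residual_mem.
have rhoK : rho \in K r.+2 by apply: residual_mem.
have dK s : d s \in K s := (dG s).1.
have e0K : e0 \in K r.+1 by rewrite rpredB // krylov_subS.
have e1K : e1 \in K r.+2 by rewrite rpredB // krylov_subS.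
have rhoO z : z \in K r.+1 -> dot z rho = 0 := (dG r.+1).2 z.
have rho0O z : z \in K r -> dot z rho0 = 0 := (dG r).2 z.
have rho2O z : z \in K r.+2 -> dot z rho2 = 0 := (dG r.+2).2 z.
have rhoAe1 : dot rho (A *m e1) = - dot rho rho.
  by rewrite Ae1 dotBr rho2O // sub0r.
have rhoAe0 : dot rho (A *m e0) = dot rho rho.
  by rewrite Ae0 dotBr (dotC _ rho0) (rhoO _ rho0K) subr0.
have e1NK : e1 \notin K r.+1.
  apply/negP => h; have := rhoAe1.
  suff -> : e1 = 0 by rewrite mulmx0 dot0r; lra.
  by apply: (pdK h); rewrite Ae1 dotBr rho2O // rhoO // subrr.
have e0NK : e0 \notin K r.
  apply/negP => h; have := rhoAe0.
  suff -> : e0 = 0 by rewrite mulmx0 dot0r; lra.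
  by apply: (pdK h); rewrite Ae0 dotBr rho0O // rhoO // subrr.
have d1e0 : 0 <= dot (d r.+1) e0.
  by rewrite -[d r.+1](subrK (d r)) dotDl addr_ge0 // dot_ge0.
have d1rho := rhoO _ (dK r.+1).
clearbody e0 e1 rho rho0 rho2.
have [u uK [b rhoE]] := krylov_complete e1K e1NK rhoK.
have [u' u'K [a uE]] := krylov_complete e0K e0NK uK.
have u'0 : u' = 0.
  have u'E : u' = rho - b *: e1 - a *: e0 by rewrite rhoE uE !addrK.
  apply: (pdK u'K); rewrite {2}u'E.
  rewrite !mulmxBr -!scalemxAr !dotBr !dotZr Ae0 Ae1 !dotBr.
  rewrite (rho0O _ u'K) (rhoO _ (krylov_subS u'K)).
  rewrite (rho2O _ (krylov_subS (krylov_subS u'K))).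
  by rewrite dot_symmx // dotC (rhoO _ (krylov_mul u'K)); ring.
have rhoE2 : rho = a *: e0 + b *: e1 by rewrite rhoE uE u'0 add0r.
have e0Ae1 : dot e0 (A *m e1) = 0.
  by rewrite Ae1 dotBr rhoO // rho2O ?subrr // krylov_subS.
have e0p := pA e0; have e1p := pA e1.
have Ea : a * dot e0 (A *m e0) = dot rho rho.
  by rewrite -rhoAe0 {1}rhoE2 dotDl !dotZl (dot_symmx e1) // e0Ae1 mulr0 addr0.
have Eb : b * dot e1 (A *m e1) = - dot rho rho.
  by rewrite -rhoAe1 {1}rhoE2 dotDl !dotZl e0Ae1 mulr0 add0r.
have ap : 0 < a by rewrite ltNge; apply/negP => h; nra.
have bn : b < 0 by rewrite ltNge; apply/negP => h; nra.
move: d1rho d1e0; rewrite rhoE2 dotDr !dotZr.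
move: (dot (d r.+1) e0) (dot (d r.+1) e1) => p q pq p0; nra.
Qed.

Lemma iterate_norm_monotone r s : (r <= s)%N ->
  dot (d r) (d r) <= dot (d s) (d s).
Proof.
move=> /subnK <-; elim: (s - r)%N => // k IH; apply: le_trans IH _.
rewrite addSn; have := iterate_dot_increment_ge0 (k + r).
set x := d _; set y := d _.+1; rewrite dotBr.
by have := dot_ge0 (y - x); rewrite !(dotBl, dotBr) (dotC y x); lra.
Qed.

(** As long as the residual is nonzero it enlarges the Krylov space, which can
    happen at most [n] times. *)
Lemma ex_exact_iterate : exists s, A *m d s + g = 0.
Proof.
apply/not_existsP => h.
have dimK s : (s <= \dim (K s))%N.
  elim: s => // s IH; apply: (leq_ltn_trans IH).
  have sub : (K s <= K s.+1)%VS by apply/subvP; apply: krylov_subS.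
  rewrite (ltn_leqif (dimv_leqif_sup sub)); apply/negP => /subvP.
  by move=> /(_ _ (residual_mem s))/(dG s).2/dot_eq0; apply: h.
have := leq_trans (dimK (n * 1).+1) (dimvS (subvf _)).
by rewrite dimvf /dim /= ltnn.
Qed.

End Chain.

(** Every Galerkin iterate is shorter than the exact solution reached when the
    Krylov spaces become stationary. *)
Lemma galerkin_norm_le_exact r dr : galerkin A g (K r) dr ->
  exists2 ds, A *m ds + g = 0 & (exists s, ds \in K s) /\ dot dr dr <= dot ds ds.
Proof.
move=> gr.
have /choice[d dG] : forall s, exists d, galerkin A g (K s) d.
  move=> s; have [d hd] := ex_krylov_update s A g; exists d.
  exact: krylov_update_galerkin.
have -> : dr = d r by apply: galerkin_unique (pdK (r := r)) gr (dG r).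
have [s hs] := ex_exact_iterate dG; exists (d s) => //; split.
  by exists s; exact: (dG s).1.
have [rs|/ltnW sr] := leqP r s; first exact: iterate_norm_monotone.
by rewrite (residual0_stationary dG sr hs).
Qed.

End Krylov.

(** * Exponential moments of a finite distribution *)

Section LogPartition.
Context {R : realType}.

(** From [exp (- u / 2) >= 1 - u / 2], squared. *)
Lemma expR_le_quadratic (u : R) : u <= 1 -> expR u <= 1 + u + 2 * u ^+ 2.
Proof.
move=> u1; have h := expR_ge1Dx (- (u / 2)).
have e0 := expR_gt0 (u / 2).
have e1 : expR (- (u / 2)) * expR (u / 2) = 1 by rewrite -expRD addNr expR0.
have -> : expR u = expR (u / 2) ^+ 2 by rewrite expr2 -expRD -splitr.
move: (expR (u / 2)) (expR (- (u / 2))) e0 e1 h => E F E0 FE h.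
have q0 : 0 < 1 - u / 2 by lra.
have h1 : E * (1 - u / 2) <= 1 by nra.
have h2 : E ^+ 2 * (1 - u / 2) ^+ 2 <= 1.
  by rewrite -exprMn expr_le1 // mulr_ge0 // ltW.
rewrite -(ler_pM2r (exprn_gt0 2 q0)); apply: le_trans h2 _.
have -> : (1 + u + 2 * u ^+ 2) * (1 - u / 2) ^+ 2
  = 1 + u ^+ 2 * ((1 - u) * (5 - 2 * u) / 4) by field.
by rewrite lerDl mulr_ge0 ?sqr_ge0 // divr_ge0 // mulr_ge0 //; lra.
Qed.

Lemma expR_ge_quadratic (r u : R) : 0 <= r -> - r <= u ->
  1 + u + u ^+ 2 / (4 + 2 * r) <= expR u.
Proof.
move=> r0 ru; have D0 : 0 < 4 + 2 * r by lra.
have [u2|u2] := leP (- 2) u.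
  have h := expR_ge1Dx (u / 2).
  have -> : expR u = expR (u / 2) ^+ 2 by rewrite expr2 -expRD -splitr.
  apply: le_trans (_ : (1 + u / 2) ^+ 2 <= _); last first.
    by rewrite lerXn2r ?nnegrE ?expR_ge0 //; lra.
  have : u ^+ 2 / (4 + 2 * r) <= u ^+ 2 / 4.
    by rewrite ler_wpM2l ?sqr_ge0 // lef_pV2 ?posrE //; lra.
  lra.
apply: le_trans (expR_ge0 u).
suff : u ^+ 2 / (4 + 2 * r) <= - 1 - u by lra.
by rewrite ler_pdivrMr //; nra.
Qed.

Definition mean m (p v : 'I_m -> R) : R := \sum_j p j * v j.

Definition wvar m (p v : 'I_m -> R) : R :=
  \sum_j p j * (v j - mean p v) ^+ 2.

(** The cumulant generating function of [v - mean p v] at 1; the Bregman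
    divergence of log-sum-exp has this form. *)
Definition centered_cgf m (p v : 'I_m -> R) : R :=
  ln (\sum_j p j * expR (v j - mean p v)).

Section Prob.
Variables (m : nat) (p : 'I_m -> R).
Hypothesis p_ge0 : forall j, 0 <= p j.
Hypothesis p_sum1 : \sum_j p j = 1.

Lemma mean_centered v : \sum_j p j * (v j - mean p v) = 0.
Proof.
under eq_bigr do rewrite mulrBr.
by rewrite sumrB -mulr_suml p_sum1 mul1r subrr.
Qed.

Lemma wvar_shift v a :
  \sum_j p j * (v j - a) ^+ 2 = wvar p v + (mean p v - a) ^+ 2.
Proof.
have -> : (mean p v - a) ^+ 2 = \sum_j p j * (mean p v - a) ^+ 2.
  by rewrite -mulr_suml p_sum1 mul1r.
have cross : \sum_j 2 * (mean p v - a) * (p j * (v j - mean p v)) = 0.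
  by rewrite -mulr_sumr mean_centered mulr0.
rewrite -[RHS]addr0 -[X in _ = _ + X]cross /wvar -!big_split /=.
by apply: eq_bigr => j _; ring.
Qed.

Lemma wvar_ge0 v : 0 <= wvar p v.
Proof. by apply: sumr_ge0 => j _; rewrite mulr_ge0 ?sqr_ge0. Qed.

Lemma wvar_le v a : wvar p v <= \sum_j p j * (v j - a) ^+ 2.
Proof. by rewrite wvar_shift lerDl sqr_ge0. Qed.

Lemma prob_le1 j : p j <= 1.
Proof. by rewrite -p_sum1 (bigD1 j) //= lerDl sumr_ge0. Qed.

Lemma second_moment v :
  \sum_j p j * v j ^+ 2 = wvar p v + mean p v ^+ 2.
Proof.
by rewrite -[mean p v]subr0 -wvar_shift; under [RHS]eq_bigr do rewrite subr0.
Qed.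

Lemma second_moment_le_sum v : \sum_j p j * v j ^+ 2 <= \sum_j v j ^+ 2.
Proof. by apply: ler_sum => j _; rewrite ler_piMl ?sqr_ge0 ?prob_le1. Qed.

Lemma wvar_le_sum v : wvar p v <= \sum_j v j ^+ 2.
Proof.
apply: le_trans (second_moment_le_sum v).
by rewrite second_moment lerDl sqr_ge0.
Qed.

Lemma sqr_centered_le v j : (v j - mean p v) ^+ 2 <= 4 * \sum_i v i ^+ 2.
Proof.
have h1 : mean p v ^+ 2 <= \sum_i v i ^+ 2.
  by apply: le_trans (second_moment_le_sum v); rewrite second_moment lerDr wvar_ge0.
have h2 : v j ^+ 2 <= \sum_i v i ^+ 2.
  by rewrite (bigD1 j) //= lerDl sumr_ge0 // => i _; rewrite sqr_ge0.
have := sqr_ge0 (v j + mean p v); nra.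
Qed.

Lemma centered_mgf_ge1 v : 1 <= \sum_j p j * expR (v j - mean p v).
Proof.
have -> : 1 = \sum_j (p j + p j * (v j - mean p v)).
  by rewrite big_split /= p_sum1 mean_centered addr0.
apply: ler_sum => j _; rewrite -{1}[p j]mulr1 -mulrDr ler_wpM2l //.
exact: expR_ge1Dx.
Qed.

Lemma centered_cgf_ge0 v : 0 <= centered_cgf p v.
Proof. exact/ln_ge0/centered_mgf_ge1. Qed.

(** Small deviations are controlled by the quadratic bound on exp, large ones by
    [u <= u^2]. *)
Lemma centered_cgf_le v : centered_cgf p v <= 8 * \sum_j v j ^+ 2.
Proof.
pose B := 4 * \sum_j v j ^+ 2.
have hB j : (v j - mean p v) ^+ 2 <= B := sqr_centered_le v j.
have B0 : 0 <= B.
  by rewrite mulr_ge0 // sumr_ge0 // => j _; rewrite sqr_ge0.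
rewrite -ler_expR lnK; last first.
  by rewrite posrE (lt_le_trans ltr01) ?centered_mgf_ge1.
apply: (@le_trans _ _ (expR (2 * B))); last by rewrite ler_expR /B; lra.
have [B1|B1] := leP B 1.
  apply: le_trans (expR_ge1Dx _).
  apply: (@le_trans _ _ (\sum_j (p j + p j * (v j - mean p v) + p j * (2 * B)))).
    apply: ler_sum => j _; rewrite -{2}[p j]mulr1 -!mulrDr ler_wpM2l //.
    have uB := hB j; have /expR_le_quadratic : v j - mean p v <= 1 by nra.
    by lra.
  by rewrite !big_split /= p_sum1 mean_centered -mulr_suml p_sum1 addr0 mul1r.
apply: (@le_trans _ _ (\sum_j p j * expR (2 * B))).
  apply: ler_sum => j _; rewrite ler_wpM2l // ler_expR.
  by have := hB j; nra.
by rewrite -mulr_suml p_sum1 mul1r.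
Qed.

(** A lower quadratic bound on exp holds only on a bounded range, whence the
    dependence of the constant on [r]. *)
Lemma centered_cgf_ge v r : 0 <= r -> (forall j, `|v j - mean p v| <= r) ->
  wvar p v / (4 + 2 * r + r ^+ 2) <= centered_cgf p v.
Proof.
move=> r0 vr; have V0 := wvar_ge0 v.
have Vr : wvar p v <= r ^+ 2.
  apply: (@le_trans _ _ (\sum_j p j * r ^+ 2)).
    apply: ler_sum => j _; rewrite ler_wpM2l //.
    by rewrite -real_normK ?num_real // lerXn2r ?nnegrE.
  by rewrite -mulr_suml p_sum1 mul1r.
have D0 : 0 < 4 + 2 * r by lra.
pose y := wvar p v / (4 + 2 * r).
have y0 : 0 <= y by rewrite divr_ge0 // ltW.
have mgf : 1 + y <= \sum_j p j * expR (v j - mean p v).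
  apply: (@le_trans _ _ (\sum_j (p j + p j * (v j - mean p v)
     + p j * ((v j - mean p v) ^+ 2) / (4 + 2 * r)))).
    by rewrite !big_split /= p_sum1 mean_centered -mulr_suml addr0.
  apply: ler_sum => j _; rewrite -{1}[p j]mulr1 -mulrA -!mulrDr ler_wpM2l //.
  by apply: expR_ge_quadratic => //; have := vr j; rewrite ler_norml => /andP[].
apply: (@le_trans _ _ (ln (1 + y))); last by rewrite ler_ln ?posrE //; lra.
apply: (@le_trans _ _ (1 - (1 + y)^-1)).
  have -> : 1 - (1 + y)^-1 = wvar p v / (4 + 2 * r + wvar p v).
    rewrite /y; field; lra.
  by rewrite ler_wpM2l // lef_pV2 ?posrE //; lra.
have y1 : 0 < 1 + y by lra.
have : ln ((1 + y)^-1) <= (1 + y)^-1 - 1.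
  have z0 : 0 < (1 + y)^-1 by rewrite invr_gt0.
  move: z0; move: (1 + y)^-1 => z z0.
  have := @le_ln1Dx R (z - 1); rewrite [1 + _]addrC subrK; apply.
  by rewrite ltrBDl subrr.
by rewrite lnV ?posrE //; lra.
Qed.

(** Sublevel sets of the cumulant generating function bound [v] up to an additive
    constant: a large positive deviation is excluded by its own exponential, and
    a large negative one would have to be balanced by positive ones. *)
Lemma centered_cgf_sublevel v h j : 0 < p j -> centered_cgf p v <= h ->
  `|v j - mean p v| <= expR h / p j.
Proof.
move=> pj; rewrite -ler_expR lnK; last first.
  by rewrite posrE (lt_le_trans ltr01) ?centered_mgf_ge1.
move=> mgf; have mgfj : p j * expR (v j - mean p v) <= expR h.
  apply: le_trans mgf; rewrite (bigD1 j) //= lerDl.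
  by apply: sumr_ge0 => i _; rewrite mulr_ge0 ?expR_ge0.
rewrite ler_norml lerNl !ler_pdivlMr // mulNr !(mulrC _ (p j)).
apply/andP; split; last first.
  apply: le_trans mgfj; rewrite ler_pM2l //.
  by have := expR_ge1Dx (v j - mean p v); lra.
have := mean_centered v; rewrite (bigD1 j) //= => /eqP.
rewrite addr_eq0 => /eqP ->; rewrite opprK.
apply: le_trans mgf; rewrite [leRHS](bigD1 j) //=.
rewrite ler_wpDl // ?mulr_ge0 ?expR_ge0 //; apply: ler_sum => i _.
by rewrite ler_wpM2l //; have := expR_ge1Dx (v i - mean p v); lra.
Qed.

End Prob.

Lemma wvar_compare m (p p0 v : 'I_m -> R) k : 0 <= k ->
  (forall j, 0 <= p0 j) -> \sum_j p0 j = 1 ->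
  (forall j, k * p0 j <= p j) -> k * wvar p0 v <= wvar p v.
Proof.
move=> k0 p00 p01 h; apply: le_trans (ler_wpM2l k0 (wvar_le p01 v (mean p v))) _.
rewrite mulr_sumr; apply: ler_sum => j _.
by rewrite mulrA ler_wpM2r ?sqr_ge0.
Qed.

(** Exponential tilting by a function of bounded oscillation changes the weights
    by a bounded factor. *)
Lemma tilt_ge m (p v : 'I_m -> R) r j : (forall i, 0 <= p i) ->
  \sum_i p i = 1 -> (forall i, `|v i - mean p v| <= r) ->
  expR (- (2 * r)) * p j <= p j * expR (v j) / \sum_i p i * expR (v i).
Proof.
move=> p0 p1 vr.
have vE i : expR (v i) = expR (v i - mean p v) * expR (mean p v).
  by rewrite -expRD subrK.
have -> : \sum_i p i * expR (v i)
    = (\sum_i p i * expR (v i - mean p v)) * expR (mean p v).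
  by rewrite mulr_suml; apply: eq_bigr => i _; rewrite vE mulrA.
have Z1 := centered_mgf_ge1 p0 p1 v.
have Zr : \sum_i p i * expR (v i - mean p v) <= expR r.
  apply: (@le_trans _ _ (\sum_i p i * expR r)).
    apply: ler_sum => i _; rewrite ler_wpM2l // ler_expR.
    by have := vr i; rewrite ler_norml => /andP[].
  by rewrite -mulr_suml p1 mul1r.
rewrite vE ler_pdivlMr; last by rewrite mulr_gt0 ?expR_gt0 // (lt_le_trans ltr01).
rewrite !mulrA ler_pM2r ?expR_gt0 // mulrAC (mulrC (p j)) ler_wpM2r //.
apply: (@le_trans _ _ (expR (- (2 * r)) * expR r)).
  by rewrite ler_wpM2l ?expR_ge0.
rewrite -expRD ler_expR; have := vr j; rewrite ler_norml => /andP[+ _].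
lra.
Qed.

Lemma centered_le_osc m (p v : 'I_m -> R) a r :
  (forall j, 0 <= p j) -> \sum_j p j = 1 -> (forall j, `|v j - a| <= r) ->
  forall j, `|v j - mean p v| <= 2 * r.
Proof.
move=> p0 p1 h j.
have : `|mean p v - a| <= r.
  have -> : mean p v - a = \sum_i p i * (v i - a).
    under eq_bigr do rewrite mulrBr.
    by rewrite sumrB -mulr_suml p1 mul1r.
  apply: le_trans (ler_norm_sum _ _ _) _.
  apply: (@le_trans _ _ (\sum_i p i * r)); last by rewrite -mulr_suml p1 mul1r.
  by apply: ler_sum => i _; rewrite normrM (ger0_norm (p0 i)) ler_wpM2l.
have := h j; have -> : v j - mean p v = (v j - a) - (mean p v - a) by ring.
by have := ler_normB (v j - a) (mean p v - a); lra.
Qed.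

End LogPartition.

(** * The log-sum-exp objective *)

Section Softmax.
Context {R : realType}.
Variables (m n : nat) (J : 'M[R]_(m, n)) (b : 'cV[R]_m).
Hypothesis m_gt0 : (0 < m)%N.

Definition coords k (v : 'cV[R]_k) : 'I_k -> R := fun j => v j 0.

Local Notation p x := (coords (softmax J b x)).

Lemma sumexpE x : sumexp J b x = \sum_j expR (coords (J *m x + b) j).
Proof.
by rewrite /sumexp dotE; apply: eq_bigr => j _; rewrite /coords !mxE mul1r.
Qed.

Lemma sumexp_gt0 x : 0 < sumexp J b x.
Proof.
rewrite sumexpE (bigD1 (Ordinal m_gt0)) //= ltr_wpDr ?expR_gt0 //.
by apply: sumr_ge0 => j _; rewrite expR_ge0.
Qed.

Lemma softmaxE x j : p x j = expR (coords (J *m x + b) j) / sumexp J b x.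
Proof. by rewrite /coords !mxE mulrC. Qed.

Lemma softmax_gt0 x j : 0 < p x j.
Proof. by rewrite softmaxE divr_gt0 ?expR_gt0 ?sumexp_gt0. Qed.

Lemma softmax_ge0 x j : 0 <= p x j.
Proof. exact/ltW/softmax_gt0. Qed.

Lemma softmax_sum1 x : \sum_j p x j = 1.
Proof.
under eq_bigr do rewrite softmaxE.
by rewrite -mulr_suml -sumexpE mulfV // gt_eqF // sumexp_gt0.
Qed.

Lemma expR_coordsD x d j : expR (coords (J *m (x + d) + b) j)
  = sumexp J b x * (p x j * expR (coords (J *m d) j)).
Proof.
rewrite softmaxE mulrA [sumexp _ _ _ * _]mulrC divfK ?gt_eqF ?sumexp_gt0 //.
rewrite -expRD; congr expR; rewrite /coords mulmxDr.
by rewrite !mxE addrAC.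
Qed.

Lemma sumexpD x d : sumexp J b (x + d)
  = sumexp J b x * \sum_j p x j * expR (coords (J *m d) j).
Proof.
by rewrite sumexpE mulr_sumr; apply: eq_bigr => j _; rewrite expR_coordsD.
Qed.

Lemma softmaxD x d j : p (x + d) j
  = p x j * expR (coords (J *m d) j) / \sum_i p x i * expR (coords (J *m d) i).
Proof.
rewrite softmaxE expR_coordsD sumexpD invfM mulrACA divff ?mul1r //.
by rewrite gt_eqF // sumexp_gt0.
Qed.

Lemma ln_sumexpD x d : ln (sumexp J b (x + d)) = ln (sumexp J b x)
  + mean (p x) (coords (J *m d)) + centered_cgf (p x) (coords (J *m d)).
Proof.
have Z1 := centered_mgf_ge1 (softmax_ge0 x) (softmax_sum1 x) (coords (J *m d)).
have Z0 := lt_le_trans ltr01 Z1.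
have -> : sumexp J b (x + d) = sumexp J b x
    * (expR (mean (p x) (coords (J *m d)))
    * \sum_j p x j * expR (coords (J *m d) j - mean (p x) (coords (J *m d)))).
  rewrite sumexpD; congr (_ * _); rewrite mulr_sumr; apply: eq_bigr => j _.
  by rewrite mulrCA -expRD addrC subrK.
by rewrite !lnM ?posrE ?mulr_gt0 ?expR_gt0 ?sumexp_gt0 // expRK addrA.
Qed.

Lemma softmax_hess_quad x (v : 'cV[R]_m) :
  dot v (softmax_hess J b x *m v) = wvar (p x) (coords v).
Proof.
have -> : wvar (p x) (coords v)
    = \sum_j p x j * coords v j ^+ 2 - mean (p x) (coords v) ^+ 2.
  by rewrite (second_moment (softmax_sum1 x)) addrK.
rewrite /softmax_hess mulmxBl dotBr; congr (_ - _).
  rewrite dotE; apply: eq_bigr => j _.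
  by rewrite mul_diag_mx mxE !mxE /coords !mxE expr2; ring.
have -> : softmax J b x *m (softmax J b x)^T *m v
    = dot (softmax J b x) v *: softmax J b x.
  by rewrite -mulmxA [_^T *m v]mx11_scalar mul_mx_scalar.
by rewrite dotZr (dotC v) -expr2 dotE.
Qed.

Lemma softmax_hess_sym x : (softmax_hess J b x)^T = softmax_hess J b x.
Proof. by rewrite /softmax_hess linearB /= tr_diag_mx trmx_mul trmxK. Qed.

End Softmax.

Section Objective.
Context {R : realType}.
Variables (N m n : nat) (J : 'I_N -> 'M[R]_(m, n)) (b c : 'I_N -> 'cV[R]_m).
Variable w : 'I_N -> R.
Hypothesis m_gt0 : (0 < m)%N.
Hypothesis w_gt0 : forall k, 0 < w k.

Local Notation f := (lse_objective J b c w).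
Local Notation A := (shifted_hessian J b w).
Local Notation p k x := (coords (softmax (J k) (b k) x)).
Local Notation Jv k d := (coords (J k *m d)).

(** The matrix multiplying [beta] in the shifted Hessian; it also bounds the
    Hessians of [f] from above. *)
Definition gram : 'M[R]_n := \sum_k w k *: ((J k)^T *m J k).

Definition lse_grad x : 'cV[R]_n :=
  \sum_k w k *: ((J k)^T *m (softmax (J k) (b k) x - c k)).

Let w_ge0 k : 0 <= w k := ltW (w_gt0 k).
Let p_gt0 k x j : 0 < p k x j := softmax_gt0 _ _ m_gt0 x j.
Let p_ge0 k x j : 0 <= p k x j := softmax_ge0 _ _ m_gt0 x j.
Let p_sum1 k x : \sum_j p k x j = 1 := softmax_sum1 _ _ m_gt0 x.

Lemma dot_lse_grad x d : dot (lse_grad x) d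
  = \sum_k w k * (mean (p k x) (Jv k d) - dot (c k) (J k *m d)).
Proof.
rewrite /lse_grad dot_suml; apply: eq_bigr => k _.
by rewrite dotZl -dot_adjoint dotBl dotE.
Qed.

(** Exponentials turn the increment [d] into a tilt of the softmax weights at [x],
    so that the second-order remainder depends on [x] only through these. *)
Lemma lse_bregman x d : f (x + d) = f x + dot (lse_grad x) d
  + \sum_k w k * centered_cgf (p k x) (Jv k d).
Proof.
rewrite /lse_objective dot_lse_grad -!big_split /=; apply: eq_bigr => k _.
by rewrite ln_sumexpD // mulmxDr dotDr; ring.
Qed.

Lemma gram_quad d : dot d (gram *m d) = \sum_k w k * dot (J k *m d) (J k *m d).
Proof.
rewrite /gram mulmx_suml dot_sumr; apply: eq_bigr => k _.
by rewrite -scalemxAl dotZr -mulmxA dot_adjoint trmxK.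
Qed.

Lemma shifted_hessianE beta x : A beta x = A 0 x + beta *: gram.
Proof.
rewrite /shifted_hessian /gram scaler_sumr -big_split /=; apply: eq_bigr => k _.
rewrite raddf0 addr0 mulmxDr mulmxDl scalerDr; congr (_ + _).
by rewrite mul_mx_scalar -scalemxAl !scalerA mulrC.
Qed.

Lemma hessian_quad x d :
  dot d (A 0 x *m d) = \sum_k w k * wvar (p k x) (Jv k d).
Proof.
rewrite /shifted_hessian mulmx_suml dot_sumr; apply: eq_bigr => k _.
rewrite raddf0 addr0 -scalemxAl dotZr -!mulmxA dot_adjoint trmxK.
by rewrite softmax_hess_quad.
Qed.

Lemma gram_psd : psdmx gram.
Proof.
split=> [|v].
  rewrite /gram linear_sum; apply: eq_bigr => k _.
  by rewrite linearZ /= trmx_mul trmxK.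
by rewrite gram_quad sumr_ge0 // => k _; rewrite mulr_ge0 ?dot_ge0.
Qed.

Lemma hessian_psd x : psdmx (A 0 x).
Proof.
split=> [|v].
  rewrite /shifted_hessian linear_sum; apply: eq_bigr => k _.
  by rewrite raddf0 addr0 linearZ /= !trmx_mul trmxK softmax_hess_sym mulmxA.
rewrite hessian_quad sumr_ge0 // => k _.
by rewrite mulr_ge0 // wvar_ge0.
Qed.

Lemma shifted_hessian_quad beta x d : dot d (A beta x *m d)
  = dot d (A 0 x *m d) + beta * dot d (gram *m d).
Proof. by rewrite shifted_hessianE mulmxDl dotDr -scalemxAl dotZr. Qed.

Lemma shifted_hessian_psd beta x : 0 <= beta -> psdmx (A beta x).
Proof.
move=> b0; have [sH pH] := hessian_psd x; have [sG pG] := gram_psd; split=> [|v].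
  by rewrite shifted_hessianE linearD linearZ /= sH sG.
by rewrite shifted_hessian_quad addr_ge0 // mulr_ge0.
Qed.

Lemma sum_coords_sqr k (v : 'cV[R]_k) : \sum_j coords v j ^+ 2 = dot v v.
Proof. by rewrite dotE; apply: eq_bigr => j _; rewrite expr2. Qed.

Lemma hessian_le_gram x d : dot d (A 0 x *m d) <= dot d (gram *m d).
Proof.
rewrite hessian_quad gram_quad; apply: ler_sum => k _; rewrite ler_pM2l //.
by rewrite -sum_coords_sqr wvar_le_sum.
Qed.

Lemma lse_convex x d : f x + dot (lse_grad x) d <= f (x + d).
Proof.
rewrite lse_bregman lerDl sumr_ge0 // => k _.
by rewrite mulr_ge0 // centered_cgf_ge0.
Qed.

Lemma lse_smooth x d :
  f (x + d) <= f x + dot (lse_grad x) d + 8 * dot d (gram *m d).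
Proof.
rewrite lse_bregman lerD2l gram_quad mulr_sumr; apply: ler_sum => k _.
by rewrite mulrCA ler_pM2l // -sum_coords_sqr centered_cgf_le.
Qed.

(** The two bounds squeeze the difference quotient. *)
Lemma lse_derive x v : 'D_v f x = dot (lse_grad x) v.
Proof.
rewrite /derive; apply: cvg_lim => //; apply/cvgrPdist_lt => e e0.
pose q := 8 * dot v (gram *m v) + 1.
have q0 : 0 < q by rewrite ltr_wpDl // mulr_ge0 // gram_psd.2.
near=> h; have h0 : h != 0 by near: h; exact: nbhs_dnbhs_neq.
have hq : `|h| < e / q by near: h; apply: dnbhs0_lt; rewrite divr_gt0.
rewrite /GRing.scale /= (addrC _ x).
have := lse_convex x (h *: v); have := lse_smooth x (h *: v).
rewrite -scalemxAr !(dotZr, dotZl).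
move: (f (x + h *: v)) (f x) (dot (lse_grad x) v) => F F0 a up lo.
have hp : 0 < `|h| by rewrite normr_gt0.
rewrite distrC; have -> : h^-1 * (F - F0) - a = (F - F0 - h * a) / h by field.
rewrite normrM normfV ltr_pdivrMr // ger0_norm; last by lra.
move: hq; rewrite ltr_pdivlMr // => hq.
apply: le_lt_trans (_ : `|h| * (`|h| * q) < _); last first.
  by rewrite mulrC ltr_pM2r // mulrC.
rewrite mulrA -expr2 real_normK ?num_real // /q.
have := sqr_ge0 h; nra.
Unshelve. all: by end_near. Qed.

Lemma lse_gradientE x : gradient f x = lse_grad x.
Proof.
apply/colP => j; rewrite mxE lse_derive dotE (bigD1 j) //= !mxE !eqxx mulr1.
by rewrite big1 ?addr0 // => i ij; rewrite !mxE (negbTE ij) mulr0.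
Qed.

End Objective.

(** * Geometry of the objective around a minimizer *)

(** For [q] the energy of a solution and [g] the value of the right-hand side at
    it: dividing the squared energy inequality by [q]. *)
Lemma coercive_solution_bound (R : realFieldType) (mu C q g G : R) :
  0 < mu -> 0 < C -> 0 <= G -> 0 <= q -> mu * q <= - g ->
  g ^+ 2 <= C * G * q -> q <= C / mu ^+ 2 * G.
Proof.
move=> mu0 C0 G0 q0 mq gq; rewrite mulrAC ler_pdivlMr ?exprn_gt0 //.
have [->|qn0] := eqVneq q 0; first by rewrite mul0r mulr_ge0 // ltW.
have qp : 0 < q by rewrite lt_neqAle eq_sym qn0.
have h3 : (mu * q) ^+ 2 <= C * G * q.
  have mq0 : 0 <= mu * q by rewrite mulr_ge0 // ltW.
  by apply: le_trans gq; rewrite -[leRHS]sqrrN lerXn2r // nnegrE; lra.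
by rewrite -(ler_pM2l qp); lra.
Qed.

Section Minimizer.
Context {R : realType}.
Variables (N m n : nat) (J : 'I_N -> 'M[R]_(m, n)) (b c : 'I_N -> 'cV[R]_m).
Variable w : 'I_N -> R.
Hypothesis m_gt0 : (0 < m)%N.
Hypothesis w_gt0 : forall k, 0 < w k.

Local Notation f := (lse_objective J b c w).
Local Notation A := (shifted_hessian J b w).
Local Notation p k x := (coords (softmax (J k) (b k) x)).
Local Notation Jv k d := (coords (J k *m d)).
Local Notation S := (gram J w).
Local Notation grad := (lse_grad J b c w).

Variable xmin : 'cV[R]_n.
Hypothesis xminP : global_minimizer f xmin.

Let w_ge0 k : 0 <= w k := ltW (w_gt0 k).
Let p_gt0 k x j : 0 < p k x j := softmax_gt0 _ _ m_gt0 x j.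
Let p_ge0 k x j : 0 <= p k x j := softmax_ge0 _ _ m_gt0 x j.
Let p_sum1 k x : \sum_j p k x j = 1 := softmax_sum1 _ _ m_gt0 x.

Lemma lse_grad_minimizer : grad xmin = 0.
Proof.
have [L L0 hL] := quad_bound S.
(* The step [- t g] minimizes the upper bound [- t g.g + 8 L t^2 g.g]. *)
pose g := grad xmin; pose t := (16 * L)^-1.
have t0 : 0 < t by rewrite invr_gt0 mulr_gt0.
have := xminP (xmin + (- t) *: g).
have := lse_smooth J b c m_gt0 w_gt0 xmin ((- t) *: g).
rewrite -/g -scalemxAr !(dotZr, dotZl) => h1 h2.
have h3 := hL g; apply: dot_eq0; rewrite -/g.
have tL : t * L * 16 = 1 by rewrite /t; field; rewrite gt_eqF.
apply/eqP; rewrite eq_le dot_ge0 andbT.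
have {h1 h2} : t * dot g g <= 8 * (t * (t * dot g (S *m g))) by lra.
have h4 : t * (t * dot g (S *m g)) <= t * (t * (L * dot g g)).
  by rewrite !ler_pM2l.
have tLg : 16 * (t * (t * (L * dot g g))) = t * dot g g.
  by transitivity (t * L * 16 * (t * dot g g)); [ring | rewrite tL mul1r].
by move=> h5; rewrite -(pmulr_rle0 _ t0); lra.
Qed.

(** On the kernel of the Hessian at one point, every [J k] takes constant
    vectors, along which all softmax weights are invariant; that kernel is
    hence the space along which [f] is affine. *)
Lemma hessian_kernel x y z : A 0 x *m z = 0 ->
  A 0 y *m z = 0 /\ dot (grad y) z = dot (grad x) z.
Proof.
move=> z0.
have zk k : exists a, forall j, Jv k z j = a.
  exists (mean (p k x) (Jv k z)) => j.
  have /eqP : dot z (A 0 x *m z) = 0 by rewrite z0 dot0r.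
  rewrite hessian_quad // psumr_eq0 => [|i _]; last by rewrite mulr_ge0 ?wvar_ge0.
  move=> /allP/(_ k (mem_index_enum _)); rewrite mulf_eq0 gt_eqF //=.
  rewrite psumr_eq0 => [|i _]; last by rewrite mulr_ge0 ?sqr_ge0.
  move=> /allP/(_ j (mem_index_enum _)); rewrite mulf_eq0 gt_eqF //=.
  by rewrite sqrf_eq0 subr_eq0 => /eqP.
have mk k q : \sum_j q j = 1 -> mean q (Jv k z) = mean (p k x) (Jv k z).
  have [a ha] := zk k; move=> q1; rewrite /mean.
  under eq_bigr do rewrite ha; under [RHS]eq_bigr do rewrite ha.
  by rewrite -!mulr_suml q1 p_sum1.
split.
  apply: (psd_kernel (hessian_psd _ _ m_gt0 w_gt0 y)).
  rewrite hessian_quad // big1 // => k _.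
  rewrite /wvar big1 ?mulr0 // => j _; have [a ha] := zk k.
  by rewrite mk // /mean; under eq_bigr do rewrite ha;
     rewrite -mulr_suml p_sum1 mul1r ha subrr expr0n mulr0.
rewrite [LHS]dot_lse_grad [RHS]dot_lse_grad; apply: eq_bigr => k _.
by rewrite (mk k _ (p_sum1 k y)).
Qed.

Local Notation Q := (A 0 xmin).

Lemma lse_grad_kernel x z : Q *m z = 0 -> dot (grad x) z = 0.
Proof.
by move=> /(@hessian_kernel _ x) [_ ->]; rewrite lse_grad_minimizer dot0l.
Qed.

(** Since the gradient vanishes at [xmin], the excess [f x - f xmin] is a sum of
    nonnegative generating functions, each of which it therefore bounds.  This
    replaces compactness of the sublevel sets, which may be unbounded. *)
Lemma sublevel_bound h : exists2 r, 0 <= r &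
  forall x, f x <= f xmin + h -> forall k j,
    `|Jv k (x - xmin) j - mean (p k xmin) (Jv k (x - xmin))| <= r.
Proof.
pose e k j := expR (h / w k) / p k xmin j.
have e0 k j : 0 <= e k j by rewrite divr_ge0 ?expR_ge0.
exists (\sum_k \sum_j e k j); first by do 2! [apply: sumr_ge0 => ? _].
move=> x fx k j; apply: (@le_trans _ _ (e k j)); last first.
  rewrite (bigD1 k) //= ler_wpDr //; first by do 2! [apply: sumr_ge0 => ? _].
  by rewrite (bigD1 j) //= ler_wpDr // sumr_ge0.
apply: centered_cgf_sublevel => //.
rewrite ler_pdivlMr // mulrC.
have := lse_bregman J b c w m_gt0 xmin (x - xmin).
rewrite addrC subrK lse_grad_minimizer dot0l addr0 => fE.
have : \sum_k w k * centered_cgf (p k xmin) (Jv k (x - xmin)) <= h by lra.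
apply: le_trans; rewrite (bigD1 k) //= lerDl sumr_ge0 // => i _.
by rewrite mulr_ge0 // centered_cgf_ge0.
Qed.

(** The weights at [x] are a bounded tilt of those at [xmin], and a variance is
    monotone in the weights up to their ratio. *)
Lemma sublevel_hessian h : exists2 mu, 0 < mu & forall x, f x <= f xmin + h ->
  forall d, mu * dot d (Q *m d) <= dot d (A 0 x *m d).
Proof.
have [r r0 hr] := sublevel_bound h; exists (expR (- (2 * r))).
  exact: expR_gt0.
move=> x /hr hx d; rewrite [leRHS]hessian_quad //.
rewrite [X in _ * X <= _]hessian_quad // mulr_sumr; apply: ler_sum => k _.
rewrite mulrCA ler_pM2l //; apply: wvar_compare => // j.
have xE : x = xmin + (x - xmin) by rewrite addrC subrK.
by rewrite [in leRHS]xE softmaxD //; apply: tilt_ge.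
Qed.

(** Strong convexity modulo the kernel of [Q], applied between [x] and [xmin],
    together with the orthogonality of gradients to that kernel. *)
Lemma gradient_domination h : exists2 C, 0 < C & forall x, f x <= f xmin + h ->
  f x - f xmin <= C * dot (grad x) (grad x).
Proof.
have [r r0 hr] := sublevel_bound h; have [mu mu0 hmu] := sublevel_hessian h.
have [C C0 hC] := psd_range_bound (hessian_psd J b m_gt0 w_gt0 xmin).
pose D := 4 + 2 * (2 * r) + (2 * r) ^+ 2.
have D0 : 0 < D by rewrite /D; have := sqr_ge0 (2 * r); lra.
pose nu := mu / D; have nu0 : 0 < nu by rewrite divr_gt0.
exists (C / (4 * nu)); first by rewrite divr_gt0 // mulr_gt0.
move=> x xh; pose d := x - xmin.
have := lse_bregman J b c w m_gt0 x (- d); rewrite dotNr.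
have -> : x - d = xmin by rewrite /d opprB addrC subrK.
have low : nu * dot d (Q *m d)
    <= \sum_k w k * centered_cgf (p k x) (Jv k (- d)).
  apply: (@le_trans _ _ (dot d (A 0 x *m d) / D)).
    by rewrite /nu mulrAC ler_pM2r ?invr_gt0 // hmu.
  have -> : dot d (A 0 x *m d) = dot (- d) (A 0 x *m (- d)).
    by rewrite mulmxN dotNr dotNl opprK.
  rewrite hessian_quad // mulr_suml; apply: ler_sum => k _.
  rewrite -mulrA ler_pM2l //; apply: centered_cgf_ge => //; first lra.
  apply: (@centered_le_osc _ _ _ _ (- mean (p k xmin) (Jv k d))) => // j.
  rewrite /coords mulmxN mxE -opprD normrN; exact: hr.
move=> fE.
have := hC (grad x) d (@lse_grad_kernel x).
have := (hessian_psd J b m_gt0 w_gt0 xmin).2 d.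
have := dot_ge0 (grad x); have {fE low} : f x - f xmin
   <= dot (grad x) d - nu * dot d (Q *m d) by lra.
move: (f x - f xmin) (dot (grad x) d) (dot (grad x) (grad x)) (dot d _).
move=> F a G s hF G0 s0 as_.
apply: le_trans hF _.
have CG : 0 <= C / (4 * nu) * G by rewrite mulr_ge0 // divr_ge0 // ltW // mulr_gt0.
have nus : 0 <= nu * s by rewrite mulr_ge0 // ltW.
suff : a <= C / (4 * nu) * G + nu * s by lra.
have CGs : C * G * s = 4 * ((C / (4 * nu) * G) * (nu * s)).
  by field; rewrite gt_eqF.
move: as_; rewrite CGs; move: CG nus; move: (_ / _ * G) (nu * s) => y z y0 z0 h1.
have : a ^+ 2 <= (y + z) ^+ 2 by have := sqr_ge0 (y - z); lra.
move=> h2; rewrite leNgt; apply/negP => h3; nra.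
Qed.

Lemma gram_kernel (z : 'cV_n) : S *m z = 0 -> forall k, J k *m z = 0.
Proof.
move=> Sz k; apply: dot_eq0.
have /eqP : dot z (S *m z) = 0 by rewrite Sz dot0r.
rewrite gram_quad psumr_eq0 => [|i _]; last by rewrite mulr_ge0 ?dot_ge0.
by move=> /allP/(_ k (mem_index_enum _)); rewrite mulf_eq0 gt_eqF //= => /eqP.
Qed.

Lemma shifted_hessian_kernel beta x (z : 'cV_n) : S *m z = 0 -> A beta x *m z = 0.
Proof.
move=> /gram_kernel Jz; rewrite /shifted_hessian mulmx_suml big1 // => k _.
by rewrite -scalemxAl -mulmxA Jz mulmx0 scaler0.
Qed.

(** Krylov vectors lie in the span of the rows of the [J k], where the shifted
    Hessian is definite although it may be singular on the whole space. *)
Lemma krylov_orthogonal beta x r v z : 0 <= beta ->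
  v \in krylov r (A beta x) (grad x) -> S *m z = 0 -> dot v z = 0.
Proof.
move=> b0 vK Sz; move: r v vK; apply: krylov_ind => [|u v hu hv|a u hu||u].
- by rewrite dot0l.
- by rewrite dotDl hu hv addr0.
- by rewrite dotZl hu mulr0.
- rewrite /lse_grad dot_suml big1 // => k _.
  by rewrite dotZl -(dot_adjoint (J k)) gram_kernel // dot0r mulr0.
- rewrite dotC (dot_symmx _ _ (shifted_hessian_psd _ _ m_gt0 w_gt0 x b0).1).
  by rewrite shifted_hessian_kernel // dot0r.
Qed.

Lemma shifted_hessian_definite beta x r : 0 < beta ->
  definite_on (A beta x) (krylov r (A beta x) (grad x)).
Proof.
move=> b0 v vK; rewrite shifted_hessian_quad => v0.
have h1 := (hessian_psd J b m_gt0 w_gt0 x).2 v.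
have h2 := (gram_psd J w_gt0).2 v.
have Sv : S *m v = 0.
  apply: (psd_kernel (gram_psd J w_gt0)).
  by apply/eqP; rewrite eq_le h2 andbT -(pmulr_rle0 _ b0); lra.
by apply: dot_eq0; apply: krylov_orthogonal vK Sv; apply: ltW.
Qed.

(** The exact solution of the shifted Newton equation stays of the size of the
    gradient as [beta] tends to 0.  The Hessian controls [dQd]; testing the
    equation against the kernel of [Q] gives an equation free of [beta], namely
    that [S d] is orthogonal to this kernel, and this controls the component of
    [d] in it. *)
Lemma exact_newton_bound h : exists2 C, 0 < C &
  forall x beta d, f x <= f xmin + h -> 0 < beta ->
    A beta x *m d + grad x = 0 -> (forall z, S *m z = 0 -> dot d z = 0) ->
    dot d d <= C * dot (grad x) (grad x).
Proof.
have [mu mu0 hmu] := sublevel_hessian h.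
have pQ := hessian_psd J b m_gt0 w_gt0 xmin; have pS := gram_psd J w_gt0.
have [C1 C10 hC1] := psd_range_bound pQ.
have [C2 C20 hC2] := psd_coercive pS.
have [C3 C30 hC3] := psd_compare pQ pS.
exists (C2 * (C3 * (C1 / mu ^+ 2))).
  by rewrite !mulr_gt0 // invr_gt0 exprn_gt0.
move=> x beta d xh b0 dE dW.
have dQd := pQ.2 d; have dSd := pS.2 d.
have G0 := dot_ge0 (grad x).
have step1 : dot d (Q *m d) <= C1 / mu ^+ 2 * dot (grad x) (grad x).
  have : dot d (A beta x *m d + grad x) = 0 by rewrite dE dot0r.
  rewrite dotDr shifted_hessian_quad (dotC d (grad x)) => e1.
  have bS : 0 <= beta * dot d (S *m d) by rewrite mulr_ge0 // ltW.
  have h1 := hmu x xh d; have h2 := hC1 _ d (@lse_grad_kernel x).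
  apply: (coercive_solution_bound mu0 C10 G0 dQd) h2.
  move: e1 => /eqP; rewrite addr_eq0 => /eqP <-.
  by rewrite (le_trans h1) // lerDl.
have step2 : dot d (S *m d) <= C3 * dot d (Q *m d).
  apply: hC3 => z Qz; have [Az gz] := hessian_kernel x Qz.
  have gz0 : dot z (grad x) = 0 by rewrite dotC; exact: lse_grad_kernel.
  have AdE : A beta x *m d = - grad x by apply/eqP; rewrite -addr_eq0 dE.
  have : dot z (A beta x *m d) = 0 by rewrite AdE dotNr gz0 oppr0.
  rewrite shifted_hessianE mulmxDl dotDr -scalemxAl dotZr.
  rewrite [X in X + _ = _](dot_symmx _ _ (hessian_psd J b m_gt0 w_gt0 x).1).
  rewrite Az dot0r add0r => /eqP.
  by rewrite mulf_eq0 (gt_eqF b0) orFb => /eqP Sdz; rewrite dotC.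
apply: le_trans (hC2 d dW) _; rewrite -!mulrA ler_pM2l //.
apply: le_trans step2 _; rewrite ler_pM2l //.
by apply: le_trans step1 _; rewrite mulrA.
Qed.

(** The bound for exact solutions passes to truncated ones since the latter are
    shorter. *)
Lemma krylov_step_bound h : exists2 C, 0 < C &
  forall x beta r d, f x <= f xmin + h -> 0 < beta ->
    galerkin (A beta x) (grad x) (krylov r (A beta x) (grad x)) d ->
    dot d d <= C * dot (grad x) (grad x).
Proof.
have [C C0 hC] := exact_newton_bound h; exists C => // x beta r d xh b0 gd.
have [ds dsE [[s dsK] le]] := galerkin_norm_le_exact
  (shifted_hessian_psd J b m_gt0 w_gt0 x (ltW b0))
  (fun s => @shifted_hessian_definite beta x s b0) gd.
apply: le_trans le _; have bge0 := ltW b0; apply: (hC x beta ds) => // z.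
exact: krylov_orthogonal bge0 dsK.
Qed.

End Minimizer.

(** * Sequences with geometrically small steps *)

Section GeometricSteps.
Context {R : realType}.

Lemma normr_coord_le n (v : 'cV[R]_n) i : `|v i 0| <= `|v|.
Proof.
have -> : `|v| = mx_norm v by [].
by rewrite mx_normrE; apply: (le_bigmax _ (fun k => `|v k.1 k.2|) (i, 0)).
Qed.

Lemma geometric_increments_cvg (v : nat -> R) M q : 0 < q < 1 ->
  (forall i, (v i.+1 - v i) ^+ 2 <= M * q ^+ i) -> cvgn v.
Proof.
move=> /andP[q0 q1] hv; pose t := Num.sqrt q.
have t1 : `|t| < 1 by rewrite ger0_norm ?sqrtr_ge0 // -sqrtr1 ltr_sqrt.
have M0 : 0 <= M.
  by have := le_trans (sqr_ge0 _) (hv 0%N); rewrite expr0 mulr1.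
have hn i : `|telescope v i| <= geometric (Num.sqrt M) t i.
  rewrite -sqrtr_sqr /geometric /=.
  apply: le_trans (ler_wsqrtr (hv i)) _.
  have -> : q ^+ i = (t ^+ i) ^+ 2 by rewrite exprAC sqr_sqrtr // ltW.
  by rewrite sqrtrM // sqrtr_sqr ger0_norm // exprn_ge0 // sqrtr_ge0.
have : cvgn [normed series (telescope v)].
  apply: series_le_cvg (is_cvg_geometric_series t1) => [i|i|i]; last exact: hn.
    exact: normr_ge0.
  exact: le_trans (hn i).
move=> /normed_cvg; rewrite telescopeK => vcvg.
have -> : v = (fun i => (v i - v 0%N) + v 0%N).
  by apply/funext => i; rewrite subrK.
by apply: is_cvgD => //; apply: is_cvg_cst.
Qed.

Lemma geometric_steps_cvg n (u : nat -> 'cV[R]_n) M q : 0 < q < 1 ->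
  (forall i, dot (u i.+1 - u i) (u i.+1 - u i) <= M * q ^+ i) ->
  exists l : 'cV[R]_n, u i @[i --> \oo] --> l.
Proof.
move=> q01 hu.
have ucvg j : cvgn (fun i => u i j 0).
  apply: (geometric_increments_cvg (M := M) q01) => i.
  by have := le_trans (sqr_coord_le_dot _ j) (hu i); rewrite !mxE.
exists (\col_j limn (fun i => u i j 0)); apply/cvgrPdist_le => e e0.
have : \forall i \near \oo, forall j, `|limn (fun i => u i j 0) - u i j 0| <= e.
  apply: filter_forall => j.
  by have /cvgrPdist_le := ucvg j; apply.
apply: filterS => i hi.
have -> : forall x : 'cV[R]_n, `|x| = mx_norm x by [].
rewrite mx_normrE; apply: bigmax_le => [|[j k] _]; first exact: ltW.
by rewrite ord1 !mxE.
Qed.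

End GeometricSteps.

(** * The LSEMINK iteration *)

Lemma ex_trial_update (R : realType) n (ktol : R) kmaxiter (A : 'M[R]_n) g :
  (1 <= kmaxiter)%N -> exists d, trial_update ktol kmaxiter A g d.
Proof.
move=> k1.
pose P r := `[< (1 <= r)%N /\ exists d, krylov_update r A g d /\
  krylov_stop ktol kmaxiter A g r d >].
have exP : exists r, P r.
  have [d hd] := ex_krylov_update kmaxiter A g.
  by exists kmaxiter; apply/asboolP; split=> //; exists d; split=> //; right.
case: (ex_minnP exP) => r /asboolP[r1 [d [hd hs]]] rmin.
exists d, r; split=> // s e /andP[s1 sr] he hse.
move: sr; rewrite ltnNge => /negP; apply; apply: rmin; apply/asboolP.
by split=> //; exists e.
Qed.

Section Step.
Context {R : realType}.
Variables (N m n : nat) (J : 'I_N -> 'M[R]_(m, n)) (b c : 'I_N -> 'cV[R]_m).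
Variables (w : 'I_N -> R) (gamma ktol : R) (kmaxiter : nat).
Hypothesis m_gt0 : (0 < m)%N.
Hypothesis w_gt0 : forall k, 0 < w k.
Hypothesis gamma01 : 0 < gamma < 1.
Hypothesis kmaxiter_ge1 : (1 <= kmaxiter)%N.

Local Notation f := (lse_objective J b c w).
Local Notation A := (shifted_hessian J b w).
Local Notation grad := (lse_grad J b c w).
Local Notation S := (gram J w).
Local Notation trial beta x := (trial_update ktol kmaxiter (A beta x) (grad x)).
Local Notation step := (lsemink_step gamma ktol kmaxiter f A).

Let gamma_gt0 : 0 < gamma.
Proof. by case/andP: gamma01. Qed.
Let subgamma_gt0 : 0 < 1 - gamma.
Proof. by rewrite subr_gt0; case/andP: gamma01. Qed.

Lemma trial_galerkin beta x d : 0 < beta -> trial beta x d ->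
  exists2 r, (0 < r)%N &
    galerkin (A beta x) (grad x) (krylov r (A beta x) (grad x)) d.
Proof.
move=> b0 [r [r1 hd _ _]]; exists r => //.
by apply: krylov_update_galerkin => //; apply: shifted_hessian_definite.
Qed.

(** On a bounded range of [beta] the forms of [A_beta] are bounded by a multiple
    of [S], hence [galerkin_descent] applies with a uniform constant. *)
Lemma trial_descent bmax : 0 <= bmax -> exists2 L, 0 < L &
  forall beta x d, 0 < beta <= bmax -> trial beta x d ->
    dot (grad x) (grad x) <= L * - dot (grad x) d.
Proof.
move=> bmax0; have [L L0 hL] := quad_bound S.
exists ((1 + bmax) * L) => [|beta x d /andP[b0 bb] /(trial_galerkin b0)[r r0 gd]].
  by rewrite mulr_gt0 // ltr_pwDl.
apply: (galerkin_descent gd); first exact/shifted_hessian_psd/ltW.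
  exact: krylov_start.
rewrite shifted_hessian_quad; have hA := hessian_le_gram J b m_gt0 w_gt0 x (grad x).
apply: (@le_trans _ _ ((1 + beta) * dot (grad x) (S *m grad x))).
  by rewrite mulrDl mul1r lerD2r.
rewrite -mulrA; apply: ler_pM => //; first by rewrite addr_ge0 // ltW.
  by have := (gram_psd J w_gt0).2 (grad x).
by rewrite lerD2l.
Qed.

(** The shift by [beta S] dominates the curvature of [f] along the trial
    direction, so that the line search accepts every large enough [beta]. *)
Lemma trial_armijo beta x d : 0 < beta -> 8 < beta * (1 - gamma) ->
  grad x <> 0 -> trial beta x d -> armijo gamma f x d.
Proof.
move=> b0 b8 g0 td; have [r r0 gd] := trial_galerkin b0 td.
have [L L0 hL] := trial_descent (ltW b0).
have y0 : 0 < - dot (grad x) d.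
  have bb : 0 < beta <= beta by rewrite b0 lexx.
  by have := lt_le_trans (dot_gt0 g0) (hL beta x d bb td); rewrite pmulr_rgt0.
rewrite /armijo lse_gradientE //.
apply: le_lt_trans (lse_smooth J b c m_gt0 w_gt0 x d) _.
have := galerkin_energy gd; rewrite shifted_hessian_quad.
have := (hessian_psd J b m_gt0 w_gt0 x).2 d; have := (gram_psd J w_gt0).2 d.
move: y0; move: (dot d (A 0 x *m d)) (dot d (S *m d)) (dot (grad x) d) (f x).
move=> a s y F y0 s0 a0 e.
have [s_eq0|sn0] := eqVneq s 0; first by nra.
have sp : 0 < s by rewrite lt_neqAle eq_sym sn0.
have h : 8 * s < beta * (1 - gamma) * s by rewrite ltr_pM2r.
have : (1 - gamma) * (beta * s) <= (1 - gamma) * - y.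
  by rewrite ler_pM2l // -e lerDr.
lra.
Qed.

Lemma ex_step x beta : 0 < beta ->
  exists x' beta', step x beta x' beta' /\ 0 < beta'.
Proof.
move=> b0; have [g0|g0] := pselect (gradient f x = 0).
  by exists x, beta; split=> //; split.
pose P j := `[< exists d, trial (2 ^+ j * beta) x d /\ armijo gamma f x d >].
have gx : gradient f x = grad x by apply: lse_gradientE.
have exP : exists j, P j.
  have c0 : 0 <= 8 / (beta * (1 - gamma)).
    by rewrite divr_ge0 // mulr_ge0 // ltW.
  exists (Num.bound (8 / (beta * (1 - gamma)))); set j := Num.bound _.
  have [d td] := ex_trial_update ktol (A (2 ^+ j * beta) x) (grad x) kmaxiter_ge1.
  apply/asboolP; exists d; split=> //; apply: trial_armijo td.
  - by rewrite mulr_gt0 // exprn_gt0.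
  - rewrite -mulrA -ltr_pdivrMr; last exact: mulr_gt0.
    apply: lt_trans (archi_boundP c0) _.
    by rewrite -natrX ltr_nat ltn_expl.
  - by rewrite -gx.
case: (ex_minnP exP) => j /asboolP[d [td ad]] jmin.
exists (x + d), (if j == 0%N then beta / 2 else 2 ^+ j * beta); split; last first.
  by case: ifP => _; rewrite ?divr_gt0 // mulr_gt0 // exprn_gt0.
split=> // _; exists j, d; rewrite gx; split=> // i e ij te ae.
move: ij; rewrite ltnNge => /negP; apply; apply: jmin; apply/asboolP.
by exists e.
Qed.

Lemma ex_lsemink_sequence x0 beta0 : 0 < beta0 -> exists x_ beta_,
  lsemink_sequence gamma ktol kmaxiter f A x0 beta0 x_ beta_.
Proof.
move=> b0.
have /choice[F hF] : forall s : 'cV[R]_n * R, exists s' : 'cV[R]_n * R,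
    0 < s.2 -> step s.1 s.2 s'.1 s'.2 /\ 0 < s'.2.
  move=> [x beta] /=; have [bp|bn] := ltP 0 beta; last first.
    by exists (x, beta); rewrite ltNge bn.
  by have [x' [beta' h]] := ex_step x bp; exists (x', beta').
pose s i := iter i F (x0, beta0).
have sp i : 0 < (s i).2 by elim: i => //= i /hF[].
exists (fun i => (s i).1), (fun i => (s i).2); split=> // i.
by have [] := hF _ (sp i).
Qed.

(** Doubling stops as soon as [beta] exceeds the threshold of the line search. *)
Lemma step_accepts bmax x beta x' beta' : 16 <= bmax * (1 - gamma) ->
  0 < beta <= bmax -> step x beta x' beta' -> 0 < beta' <= bmax /\
  (grad x = 0 -> x' = x) /\
  (grad x <> 0 -> exists t d, [/\ 0 < t <= bmax, trial t x d,
     armijo gamma f x d & x' = x + d]).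
Proof.
move=> bm /andP[b0 bb] [st0 st1].
have gx : gradient f x = grad x by apply: lse_gradientE.
rewrite gx in st0 st1.
have [g0|g0] := pselect (grad x = 0).
  by have [-> ->] := st0 g0; rewrite b0 bb.
have [j [d [[td ad] rej -> ->]]] := st1 g0.
have jb : 2 ^+ j * beta <= bmax.
  case: j td ad rej => [|j] _ _ rej; first by rewrite expr0 mul1r.
  rewrite leNgt; apply/negP => big.
  have [e te] := ex_trial_update ktol (A (2 ^+ j * beta) x) (grad x) kmaxiter_ge1.
  apply: (rej j e (ltnSn j) te); apply: trial_armijo te => //.
    by rewrite mulr_gt0 // exprn_gt0.
  have : bmax * (1 - gamma) < 2 ^+ j.+1 * beta * (1 - gamma).
    by rewrite ltr_pM2r.
  by rewrite exprS; lra.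
split; last first.
  split=> // _; exists (2 ^+ j * beta), d; split=> //.
  by rewrite jb mulr_gt0 // exprn_gt0.
case: ifP => _; last by rewrite jb mulr_gt0 // exprn_gt0.
by rewrite divr_gt0 //=; lra.
Qed.

(** An accepted step decreases [f] by a multiple of [g.g], hence by gradient
    domination by a fixed proportion of [f x - f xmin]; its squared length is
    bounded by [g.g], hence by the decrease of [f]. *)
Lemma step_contraction xmin h bmax : global_minimizer f xmin ->
  16 <= bmax * (1 - gamma) -> exists theta C, [/\ 0 < theta < 1, 0 < C &
    forall x beta x' beta', f x <= f xmin + h -> 0 < beta <= bmax ->
      step x beta x' beta' ->
      [/\ 0 < beta' <= bmax, f x' - f xmin <= theta * (f x - f xmin) &
          dot (x' - x) (x' - x) <= C * (f x - f xmin)]].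
Proof.
move=> xminP bm.
have bmax0 : 0 <= bmax by rewrite -(pmulr_lge0 _ subgamma_gt0); apply: le_trans bm.
have [Cd Cd0 hCd] := gradient_domination m_gt0 w_gt0 xminP h.
have [Ck Ck0 hCk] := krylov_step_bound m_gt0 w_gt0 xminP h.
have [L L0 hL] := trial_descent bmax0.
(* The cap 1/2 keeps the contraction factor [1 - eta] positive. *)
pose eta := Num.min (gamma / (L * Cd)) (1 / 2).
have eta0 : 0 < eta by rewrite lt_min divr_gt0 ?mulr_gt0 ?divr_gt0.
have eta2 : eta <= 1 / 2 by rewrite ge_min lexx orbT.
have etaL : eta <= gamma / (L * Cd) by rewrite ge_min lexx.
exists (1 - eta), (Ck * (L / gamma)); split; first by lra.
  by rewrite mulr_gt0 // divr_gt0.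
move=> x beta x' beta' xh bb st.
have [bb' [st0 st1]] := step_accepts bm bb st; split=> //.
  have hge := xminP x; have := hCd x xh.
  have [g0|/st1[t [d [tb td]]]] := pselect (grad x = 0).
    by rewrite g0 dot0l mulr0 st0 // => h0; nra.
  rewrite /armijo lse_gradientE // => ad -> hG; have hg := hL t x d tb td.
  move: hge hG hg ad; move: (f x) (f xmin) (f (x + d)) (dot (grad x) d).
  move=> F F0 F' y hge hG hg ad.
  have h1 : F - F0 <= Cd * (L * - y) by apply: le_trans hG _; rewrite ler_pM2l.
  have h2 : eta * (F - F0) <= gamma * - y.
    apply: (@le_trans _ _ (gamma / (L * Cd) * (F - F0))).
      by rewrite ler_wpM2r // subr_ge0.
    rewrite mulrAC ler_pdivrMr ?mulr_gt0 // -mulrA ler_pM2l //.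
    by apply: le_trans h1 _; rewrite le_eqVlt; apply/orP; left; apply/eqP; ring.
  lra.
have hge := xminP x.
have [g0|/st1[t [d [tb td]]]] := pselect (grad x = 0).
  rewrite st0 // subrr dot0l mulr_ge0 ?subr_ge0 //.
  by rewrite mulr_ge0 ?divr_ge0 // ltW.
rewrite /armijo lse_gradientE // => ad ->; rewrite addrAC subrr add0r.
have /andP[t0 _] := tb; have [r r0 gd] := trial_galerkin t0 td.
apply: le_trans (hCk x t r d xh t0 gd) _; rewrite -mulrA ler_pM2l //.
apply: le_trans (hL t x d tb td) _; rewrite -mulrA ler_pM2l //.
rewrite mulrC ler_pdivlMr //; have := xminP (x + d); lra.
Qed.

End Step.

Theorem theorem3p1 (R : realType) (N m n : nat)
  (J : 'I_N -> 'M[R]_(m, n)) (b c : 'I_N -> 'cV[R]_m) (w : 'I_N -> R)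
  (gamma beta0 ktol : R) (kmaxiter : nat) :
  (1 <= N)%N -> (1 <= m)%N -> (1 <= n)%N ->
  (forall k : 'I_N, 0 < w k) ->
  0 < gamma < 1 -> 0 < beta0 -> 0 < ktol -> (1 <= kmaxiter)%N ->
  let f := lse_objective J b c w in
  let A := shifted_hessian J b w in
  (exists xmin : 'cV[R]_n, global_minimizer f xmin) ->
  forall x0 : 'cV[R]_n,
    (exists (x_ : nat -> 'cV[R]_n) (beta_ : nat -> R),
       lsemink_sequence gamma ktol kmaxiter f A x0 beta0 x_ beta_) /\
    (forall (x_ : nat -> 'cV[R]_n) (beta_ : nat -> R),
       lsemink_sequence gamma ktol kmaxiter f A x0 beta0 x_ beta_ ->
       exists xstar : 'cV[R]_n,
         global_minimizer f xstar /\ x_ i @[i --> \oo] --> xstar).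
Proof.
move=> _ m1 _ w0 ga b0 _ k1 f A [xmin xminP] x0; split.
  exact: ex_lsemink_sequence.
move=> x_ beta_ [x_0 beta_0 st].
(* Twice the acceptance threshold: a rejected [beta] below it is doubled once. *)
pose bmax := Num.max beta0 (16 / (1 - gamma)).
have ga' : 0 < 1 - gamma by lra.
have bm : 16 <= bmax * (1 - gamma).
  by rewrite -ler_pdivrMr // le_max lexx orbT.
have [q [C [/andP[q0 q1] C0 hstep]]] :=
  step_contraction ktol m1 w0 ga k1 (f x0 - f xmin) xminP bm.
pose h i := f (x_ i) - f xmin.
have h_ge0 i : 0 <= h i by rewrite subr_ge0.
have inv i : [/\ 0 < beta_ i <= bmax & h i <= h 0%N * q ^+ i].
  elim: i => [|i [bi hi]].
    by rewrite expr0 mulr1 lexx beta_0 b0 le_max lexx.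
  have hi0 : h i <= h 0%N.
    by apply: le_trans hi _; rewrite ler_piMr // exprn_ile1 // ltW.
  have xi : f (x_ i) <= f xmin + (f x0 - f xmin).
    by move: hi0; rewrite /h x_0; lra.
  have [bi' hi' _] := hstep _ _ _ _ xi bi (st i); split=> //.
  by apply: le_trans hi' _; rewrite exprS mulrCA ler_pM2l.
have [xs hxs] : exists l : 'cV[R]_n, x_ i @[i --> \oo] --> l.
  apply: (@geometric_steps_cvg _ _ _ (C * h 0%N) q); first by rewrite q0 q1.
  move=> i; have [bi hi] := inv i.
  have xi : f (x_ i) <= f xmin + (f x0 - f xmin).
    have : h i <= h 0%N.
      by apply: le_trans hi _; rewrite ler_piMr // exprn_ile1 // ltW.
    by rewrite /h x_0; lra.
  have [_ _ hd] := hstep _ _ _ _ xi bi (st i).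
  by apply: le_trans hd _; rewrite -mulrA ler_pM2l.
(* Convexity at the limit [xs] bounds [f xs] by [f (x_ i) + g.(xs - x_ i)]. *)
exists xs; split=> // y; apply: le_trans (xminP y).
apply/ler_addgt0Pr => e e0.
pose g := lse_grad J b c w xs.
pose G := \sum_j `|g j 0| + 1.
have G0 : 0 < G by rewrite ltr_wpDl // sumr_ge0.
have hq : (fun i => h 0%N * q ^+ i) @ \oo --> 0.
  rewrite -(mulr0 (h 0%N)); apply: cvgMr; apply: cvg_expr.
  by rewrite ger0_norm // ltW.
have e2 : 0 < e / 2 by rewrite divr_gt0.
have eG : 0 < e / 2 / G by rewrite divr_gt0.
move/cvgrPdist_lt: hxs => /(_ _ eG)[i1 _ near1].
move/cvgrPdist_lt: hq => /(_ _ e2)[i2 _ near2].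
pose i := maxn i1 i2.
have n1 := near1 i (leq_maxl _ _); have n2 := near2 i (leq_maxr _ _).
have [_ hi] := inv i.
have hi2 : h i < e / 2.
  apply: le_lt_trans hi _; apply: le_lt_trans n2.
  by rewrite sub0r normrN ler_norm.
have gi : dot g (xs - x_ i) <= e / 2.
  apply: (@le_trans _ _ (G * `|xs - x_ i|)); last first.
    by rewrite mulrC -ler_pdivlMr // ltW.
  apply: (@le_trans _ _ ((\sum_j `|g j 0|) * `|xs - x_ i|)); last first.
    by rewrite ler_wpM2r // lerDl.
  rewrite dotE mulr_suml; apply: ler_sum => j _.
  by apply: le_trans (ler_norm _) _; rewrite normrM ler_wpM2l // normr_coord_le.
have := lse_convex J b c m1 w0 xs (x_ i - xs).
have -> : xs + (x_ i - xs) = x_ i by rewrite addrC subrK.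
rewrite -[x_ i - xs]opprB dotNr -/g -/f => hc.
by move: hi2; rewrite /h; lra.
Qed.
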